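(* The category $\mathsf{QCB_0}(\mathbf{HP})$ is, up to homeomorphic equivalence, the smallest full subcategory of $\mathsf{QCB_0}$ which contains the Sierpinski space as an object and inherits exponentials, countable limits and countable co-limits from $\mathsf{QCB_0}$. That is, $\mathsf{QCB_0}(\mathbf{HP})$ has these properties, and any full subcategory $\mathsf{C}$ of $\mathsf{QCB_0}$ which contains the Sierpinski space as an object and inherits exponentials, countable limits and countable co-limits from $\mathsf{QCB_0}$ contains a homeomorphic copy of every space in $\mathsf{QCB_0}(\mathbf{HP})$.
   Context: $\mathcal{N}=\omega^\omega$ is the Baire space. A qcb$_0$-space is a $T_0$ topological space which is a topological quotient of a countably based space; $\mathsf{QCB_0}$ is the category of qcb$_0$-spaces and continuous maps, which is cartesian closed, countably complete and countably co-complete. A full subcategory inherits a construction from $\mathsf{QCB_0}$ if the $\mathsf{QCB_0}$-construction applied to its objects yields its objects. The Sierpinski space $\mathbb{S}=\{\bot,\top\}$ has open sets $\emptyset,\{\top\},\{\bot,\top\}$. A representation of a space $X$ is a surjection $\delta$ from $\mathit{dom}(\delta)\subseteq\mathcal{N}$ onto $X$; it is admissible if it is continuous and every continuous $\nu\colon Z\to X$ with $Z\subseteq\mathcal{N}$ satisfies $\nu=\delta g$ for some continuous $g\colon Z\to\mathcal{N}$. $\mathit{EQ}(\delta)=\{(p,q)\in\mathcal{N}^2\mid p,q\in\mathit{dom}(\delta),\ \delta(p)=\delta(q)\}$. A family of pointclasses $\mathbf{\Gamma}$ assigns to each topological space $X$ a collection $\mathbf{\Gamma}(X)$ of subsets of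 $X$, closed under continuous preimages. Operations: $\mathbf{\Gamma}_c(X)$ = complements; $\mathbf{\Gamma}_\delta(X)$ = countable intersections; $\mathbf{\Gamma}_\exists(X)=\{\{x\mid\exists p\in\mathcal{N}.(p,x)\in A\}\mid A\in\mathbf{\Gamma}(\mathcal{N}\times X)\}$; composite subscripts applied left to right. Hyperprojective hierarchy: $\mathbf{\Sigma}^1_0(X)$ = countable unions of differences of two open sets, $\mathbf{\Sigma}^1_{\alpha+1}=(\mathbf{\Sigma}^1_\alpha)_{c\exists}$, $\mathbf{\Sigma}^1_\lambda=(\mathbf{\Sigma}^1_{<\lambda})_{\delta\exists}$ for limit $\lambda<\omega_1$, where $\mathbf{\Sigma}^1_{<\lambda}(X)=\bigcup_{\alpha<\lambda}\mathbf{\Sigma}^1_\alpha(X)$. $\mathsf{QCB_0}(\mathbf{\Gamma})$ is the class of spaces having an admissible representation $\delta$ with $\mathit{EQ}(\delta)\in\mathbf{\Gamma}(\mathcal{N}^2)$. $\mathsf{QCB_0}(\mathbf{HP})$ is the full subcategory of $\mathsf{QCB_0}$ with objects the spaces in $\bigcup_{\alpha<\omega_1}\mathsf{QCB_0}(\mathbf{\Sigma}^1_\alpha)$. *)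

(* Defs.v *)
From HB Require Import structures.
From mathcomp Require Import all_boot all_order.
From mathcomp Require Import boolp classical_sets functions cardinality filter.
From mathcomp Require Import topology.

Set Implicit Arguments.
Unset Strict Implicit.
Unset Printing Implicit Defensive.

Import Order.TTheory.
Local Open Scope classical_set_scope.

Definition baire : topologicalType := prod_topology (fun _ : nat => nat).

Definition sierpinski : Type := bool.
HB.instance Definition _ := Choice.copy sierpinski bool.

Section sierpinski_topology.

Let sierpinski_open (A : set sierpinski) :=
  [\/ A = set0, A = [set true] | A = setT].

Let sierpinski_openP A : sierpinski_open A <-> (A false -> A true).
Proof.
split=> [[]-> //|h].
have [Af|nAf] := pselect (A false).
  by constructor 3; apply/seteqP; split=> // -[] _ //; exact: h.
have [At|nAt] := pselect (A true).
  by constructor 2; apply/seteqP; split=> [[]//|_ ->].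
by constructor 1; apply/seteqP; split=> [[]|].
Qed.

Let sierpinski_openT : sierpinski_open setT.
Proof. exact: Or33. Qed.

Let sierpinski_openI : setI_closed sierpinski_open.
Proof.
move=> A B /sierpinski_openP hA /sierpinski_openP hB.
by apply/sierpinski_openP => -[Af Bf]; split; [exact: hA|exact: hB].
Qed.

Let sierpinski_open_bigU (I : Type) (f : I -> set sierpinski) :
  (forall i, sierpinski_open (f i)) -> sierpinski_open (\bigcup_i f i).
Proof.
move=> fo; apply/sierpinski_openP => -[i _ fif].
by exists i => //; exact: ((sierpinski_openP _).1 (fo i)).
Qed.

HB.instance Definition _ := isOpenTopological.Build sierpinski
  sierpinski_openT sierpinski_openI sierpinski_open_bigU.

End sierpinski_topology.

Definition homeomorphic (X Y : topologicalType) : Prop :=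
  exists (f : X -> Y) (g : Y -> X),
    [/\ continuous f, continuous g, cancel f g & cancel g f].

Definition quotient_map (Z X : topologicalType) (q : Z -> X) : Prop :=
  range q = setT /\ forall U : set X, open U <-> open (q @^-1` U).

Definition qcb0 (X : topologicalType) : Prop :=
  kolmogorov_space X /\
  exists (Z : topologicalType) (q : Z -> X),
    @second_countable Z /\ quotient_map q.

(** A full subcategory of the category of topological spaces is given by its
    class of objects; its morphisms are the continuous maps. *)
Definition space_class := topologicalType -> Prop.

Record category := Category {
  obj :> Type;
  hom : obj -> obj -> Type;
  idm : forall a, hom a a;
  comp : forall a b c, hom b c -> hom a b -> hom a c;
  comp_idl : forall a b (f : hom a b), comp (idm b) f = f;
  comp_idr : forall a b (f : hom a b), comp f (idm a) = f;
  comp_assoc : forall a b c d (h : hom c d) (g : hom b c) (f : hom a b),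
    comp h (comp g f) = comp (comp h g) f
}.

Definition countable_category (J : category) : Prop :=
  countable [set: J] /\ forall a b : J, countable [set: hom a b].

Record diagram (J : category) := Diagram {
  dobj :> J -> topologicalType;
  dmap : forall a b : J, hom a b -> dobj a -> dobj b;
  dmap_continuous : forall (a b : J) (f : hom a b), continuous (dmap f);
  dmap_id : forall a : J, dmap (idm a) = id;
  dmap_comp : forall (a b c : J) (g : hom b c) (f : hom a b),
    dmap (comp g f) = dmap g \o dmap f
}.

Section universal_constructions.
Variable K : space_class.

Definition cone (J : category) (D : diagram J) (L : topologicalType)
    (p : forall a, L -> D a) : Prop :=
  (forall a, continuous (p a)) /\
  forall (a b : J) (f : hom a b), dmap f \o p a = p b.

Definition is_limit (J : category) (D : diagram J) (L : topologicalType)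
    (p : forall a, L -> D a) : Prop :=
  [/\ K L, cone p &
    forall (Z : topologicalType) (q : forall a, Z -> D a), K Z -> cone q ->
      exists! u : Z -> L, continuous u /\ forall a, p a \o u = q a].

Definition cocone (J : category) (D : diagram J) (L : topologicalType)
    (i : forall a, D a -> L) : Prop :=
  (forall a, continuous (i a)) /\
  forall (a b : J) (f : hom a b), i b \o dmap f = i a.

Definition is_colimit (J : category) (D : diagram J) (L : topologicalType)
    (i : forall a, D a -> L) : Prop :=
  [/\ K L, cocone i &
    forall (Z : topologicalType) (j : forall a, D a -> Z), K Z -> cocone j ->
      exists! u : L -> Z, continuous u /\ forall a, u \o i a = j a].

Definition is_product (X Y P : topologicalType) (p1 : P -> X) (p2 : P -> Y) :
    Prop :=
  [/\ K P, continuous p1, continuous p2 &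
    forall (Z : topologicalType) (f : Z -> X) (g : Z -> Y),
      K Z -> continuous f -> continuous g ->
      exists! u : Z -> P, [/\ continuous u, p1 \o u = f & p2 \o u = g]].

(** [E] is the exponential [Y ^ X], with evaluation [ev] defined on the
    [K]-product [P] of [E] and [X].  The [K]-product may carry a finer topology
    than the topological product, so products are given by their universal
    property; [h] below is the map [g * id] from [Z * X] to [E * X]. *)
Definition is_exponential (X Y E P : topologicalType)
    (p1 : P -> E) (p2 : P -> X) (ev : P -> Y) : Prop :=
  [/\ K E, is_product p1 p2, continuous ev &
    forall (Z Q : topologicalType) (q1 : Q -> Z) (q2 : Q -> X) (f : Q -> Y),
      K Z -> is_product q1 q2 -> continuous f ->
      exists! g : Z -> E, continuous g /\
        exists h : Q -> P,
          [/\ continuous h, p1 \o h = g \o q1, p2 \o h = q2 & ev \o h = f]].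

(** Universal constructions are only defined up to homeomorphism: [C] inherits
    one from [K] if it contains some space that performs it in [K]. *)
Definition inherits_countable_limits (C : space_class) : Prop :=
  forall (J : category) (D : diagram J), countable_category J ->
    (forall a, C (D a)) ->
    exists (L : topologicalType) (p : forall a, L -> D a),
      C L /\ is_limit p.

Definition inherits_countable_colimits (C : space_class) : Prop :=
  forall (J : category) (D : diagram J), countable_category J ->
    (forall a, C (D a)) ->
    exists (L : topologicalType) (i : forall a, D a -> L),
      C L /\ is_colimit i.

Definition inherits_exponentials (C : space_class) : Prop :=
  forall X Y : topologicalType, C X -> C Y ->
    exists (E P : topologicalType) (p1 : P -> E) (p2 : P -> X) (ev : P -> Y),
      C E /\ is_exponential p1 p2 ev.

End universal_constructions.

Definition pointclasses := forall X : topologicalType, set (set X).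

Definition pc_compl (G : pointclasses) : pointclasses :=
  fun X => [set ~` A | A in G X].

Definition pc_delta (G : pointclasses) : pointclasses :=
  fun X => [set B | exists2 A : nat -> set X,
                      forall n, G X (A n) & B = \bigcap_n A n].

Definition pc_exists (G : pointclasses) : pointclasses :=
  fun X => [set [set x | exists p : baire, A (p, x)] |
             A in G (baire * X)%type].

Definition Sigma10 : pointclasses :=
  fun X => [set B | exists U V : nat -> set X,
    [/\ forall n, open (U n), forall n, open (V n)
      & B = \bigcup_n (U n `\` V n)]].

Section hierarchy.
Context {d : Order.disp_t} {W : orderType d}.

Definition wo_zero (w : W) : Prop := forall v : W, (w <= v)%O.

Definition wo_succ (v w : W) : Prop :=
  (v < w)%O /\ forall u : W, (u < w)%O -> (u <= v)%O.

Definition wo_limit (w : W) : Prop :=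
  ~ wo_zero w /\ forall v, ~ wo_succ v w.

Definition Sigma1_step (w : W)
    (S : forall v : W, (v < w)%O -> pointclasses) : pointclasses :=
  fun X => [set A |
    [\/ wo_zero w /\ Sigma10 A,
        exists (v : W) (vw : (v < w)%O),
          wo_succ v w /\ pc_exists (pc_compl (S v vw)) A
      | wo_limit w /\
        pc_exists (pc_delta (fun Y => [set B | exists (v : W) (vw : (v < w)%O),
                                                 S v vw Y B])) A]].

Hypothesis wfW : well_founded (fun v w : W => (v < w)%O).

(** The class of index [alpha], where [alpha] is the order type of the initial
    segment of [W] below [w]. *)
Definition Sigma1_at : W -> pointclasses :=
  Fix wfW (fun _ => pointclasses) Sigma1_step.

Lemma Sigma1_atE (w : W) :
  Sigma1_at w = Sigma1_step (fun v (_ : (v < w)%O) => Sigma1_at v).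
Proof.
rewrite /Sigma1_at Fix_eq // => x f g fg; congr (Sigma1_step _).
by apply/functional_extensionality_dep => v;
   apply/functional_extensionality_dep => vx.
Qed.

Lemma Sigma1_at_zero (w : W) : wo_zero w -> Sigma1_at w = Sigma10.
Proof.
move=> w0; rewrite Sigma1_atE; apply/functional_extensionality_dep => X.
apply/seteqP; split=> A; last by move=> ?; apply: Or31.
case=> [[]//|[v [vw _]]|[[]//]].
by have := w0 v; rewrite leNgt vw.
Qed.

Lemma Sigma1_at_succ (v w : W) : wo_succ v w ->
  Sigma1_at w = pc_exists (pc_compl (Sigma1_at v)).
Proof.
move=> vw; rewrite Sigma1_atE; apply/functional_extensionality_dep => X.
apply/seteqP; split=> A; last by move=> ?; apply: Or32; exists v, vw.1.
case=> [[w0 _]|[u [uw [suw]]]|[[_ /(_ v)]//]].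
  by have := w0 v; rewrite leNgt vw.1.
by have -> : u = v by apply/le_anti/andP; split; [exact: vw.2|exact: suw.2 vw.1].
Qed.

Lemma Sigma1_at_limit (w : W) : wo_limit w ->
  Sigma1_at w =
  pc_exists (pc_delta (fun Y => \bigcup_(v in [set v | (v < w)%O])
                                  @Sigma1_at v Y)).
Proof.
move=> wl; rewrite Sigma1_atE.
have -> : (fun Y => \bigcup_(v in [set v | (v < w)%O]) @Sigma1_at v Y) =
    (fun Y => [set B | exists (v : W) (_ : (v < w)%O), @Sigma1_at v Y B]).
  apply/functional_extensionality_dep => Y.
  by apply/seteqP; split=> B [v]; [move=> vw|case=> vw]; exists v.
apply/functional_extensionality_dep => X.
apply/seteqP; split=> A; last by move=> ?; apply: Or33.
by case=> [[/wl.1//]|[v [_ [/wl.2]]]|[_]].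
Qed.

End hierarchy.

(** A countable ordinal, presented as the order type of the set of elements
    below [co_point] in a countable well-ordered type. *)
Record countable_ordinal := CountableOrdinal {
  co_disp : Order.disp_t;
  co_type : orderType co_disp;
  co_countable : countable [set: co_type];
  co_wf : well_founded (fun v w : co_type => (v < w)%O);
  co_point : co_type
}.

Definition Sigma1 (alpha : countable_ordinal) : pointclasses :=
  Sigma1_at (@co_wf alpha) (co_point alpha).

Definition preimage_closed (G : pointclasses) : Prop :=
  forall (X Y : topologicalType) (f : X -> Y) (A : set Y),
    continuous f -> G Y A -> G X (f @^-1` A).

Lemma preimage_closed_compl G : preimage_closed G ->
  preimage_closed (pc_compl G).
Proof.
move=> hG X Y f _ cf [A GA <-]; exists (f @^-1` A); first exact: hG.
by rewrite preimage_setC.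
Qed.

Lemma preimage_closed_delta G : preimage_closed G ->
  preimage_closed (pc_delta G).
Proof.
move=> hG X Y f _ cf [A GA ->]; exists (fun n => f @^-1` A n).
  by move=> n; exact: hG.
by rewrite preimage_bigcap.
Qed.

Lemma preimage_closed_exists G : preimage_closed G ->
  preimage_closed (pc_exists G).
Proof.
move=> hG X Y f _ cf [A GA <-].
exists ((fun z : baire * X => (z.1, f z.2)) @^-1` A) => //.
apply: hG GA => z; apply: (@cvg_pair _ _ _ (nbhs z) (nbhs z.1) (nbhs (f z.2))).
  exact: cvg_fst.
by apply: (@cvg_comp _ _ _ snd f); [exact: cvg_snd|exact: cf].
Qed.

Lemma preimage_closed_Sigma10 : preimage_closed Sigma10.
Proof.
move=> X Y f _ /continuousP cf [U [V [oU oV ->]]].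
exists (fun n => f @^-1` U n), (fun n => f @^-1` V n).
by split=> [n|n|]; [exact: cf|exact: cf|rewrite preimage_bigcup].
Qed.

Lemma preimage_closed_Sigma1 (alpha : countable_ordinal) :
  preimage_closed (Sigma1 alpha).
Proof.
rewrite /Sigma1; elim/(well_founded_ind (@co_wf alpha)): (co_point alpha).
move=> w IH; rewrite Sigma1_atE => X Y f A cf.
case=> [[w0 SA]|[v [vw [svw SA]]]|[lw SA]].
- by apply: Or31; split=> //; exact: preimage_closed_Sigma10 SA.
- apply: Or32; exists v, vw; split=> //.
  by apply: preimage_closed_exists cf SA; apply: preimage_closed_compl; exact: IH.
- apply: Or33; split=> //; apply: preimage_closed_exists cf SA.
  apply: preimage_closed_delta => X' Y' g B cg [v [vw SB]].
  by exists v, vw; exact: IH SB.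
Qed.

(** A representation with domain [D] is a map on the subtype [D] rather than a
    total map on [baire], so that the empty space has one. *)
Definition representation (X : topologicalType) (D : set baire)
    (delta : D -> X) : Prop := range delta = setT.

Definition admissible (X : topologicalType) (D : set baire)
    (delta : D -> X) : Prop :=
  continuous delta /\
  forall (Z : set baire) (nu : Z -> X), continuous nu ->
    exists g : Z -> D, continuous g /\ nu = delta \o g.

Definition EQ (X : topologicalType) (D : set baire) (delta : D -> X) :
    set (baire * baire) :=
  [set pq | exists a b : D,
     [/\ set_val a = pq.1, set_val b = pq.2 & delta a = delta b]].

Definition QCB0_in (G : pointclasses) : space_class :=
  fun X => qcb0 X /\
    exists (D : set baire) (delta : D -> X),
      [/\ representation delta, admissible delta
        & G (baire * baire)%type (EQ delta)].

Definition QCB0_HP : space_class :=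
  fun X => exists alpha : countable_ordinal, QCB0_in (Sigma1 alpha) X.

Definition inheriting_subcategory (C : space_class) : Prop :=
  [/\ forall X, C X -> qcb0 X,
      C sierpinski,
      inherits_exponentials qcb0 C,
      inherits_countable_limits qcb0 C
    & inherits_countable_colimits qcb0 C].

(* Main.v *)
(** A space with a representation by a subset of the Baire space carries, in
    all cases of interest, the final topology of that representation, so its
    continuous maps can be studied on names.  If such a quotient representation
    has hyperprojective equality and the space is T0, then naming a point by the
    enumerations of the set of codes of its open neighbourhoods gives an
    admissible representation whose equality is still hyperprojective, because
    hyperprojective sets are closed under complements, countable unions,
    quantifiers over the Baire space and continuous preimages.  Hence limits,
    colimits and exponentials stay in the category as soon as each of them is
    described by some quotient representation with hyperprojective equality.

    For minimality, let [C] inherit the constructions.  For a map [phi : T -> X]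
    from a space of [C] to a Hausdorff space of [C], the points outside the range
    of [phi] form an equalizer of two maps from [X] to the exponential of the
    Sierpinski space by [T].  Thus the subspaces lying in [C] are closed under
    complements and projections, hence contain all hyperprojective subsets of
    the Baire space.  Finally, a space with an admissible representation [delta]
    is the coequalizer of the two projections of [EQ delta] to the domain of
    [delta]. *)

From HB Require Import structures.
From mathcomp Require Import all_boot all_order.
From mathcomp Require Import boolp classical_sets functions cardinality.
From mathcomp Require Import topology.
Require Import Defs.

Set Implicit Arguments.
Unset Strict Implicit.
Unset Printing Implicit Defensive.

Import Order.TTheory.
Local Open Scope classical_set_scope.

(** * Topological preliminaries *)

(** The constructions stay inside the hierarchy because an open subset of a represented space is
    coded by a point of the Baire space, an enumeration of cylinders covering its set of names.
    Quantifying over open sets, as T0 identifications require, then becomes quantifying over codes.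
    The obstacle is uniformity: membership must be open jointly in a name and a code, while the
    product of a quotient map with an identity need not be a quotient map. Joint openness is
    recovered along continuous maps from first countable spaces, where convergent sequences suffice
    as tests. The universal properties range over all qcb0-spaces; their continuity claims are
    reduced to maps from subsets of the Baire space, which do lift to names. Indices are a second
    difficulty: each countable ordinal lives in its own well-ordered type, so levels are compared by
    rank and suprema are formed by ordinal sums. The subspaces in the minimality argument are taken
    in second countable Hausdorff spaces, because there subspaces and topological products are again
    qcb0 and serve as the categorical ones. *)

Definition agree (n : nat) (p q : baire) := forall i, (i < n)%N -> p i = q i.

Lemma nbhs_baireP (p : baire) (A : set baire) :
  nbhs p A <-> exists n, forall q, agree n p q -> A q.
Proof.
split; last first.
  case=> n nA.
  suff: nbhs p [set q | agree n p q] by apply: filterS => q /nA.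
  elim: n {nA} => [|n IH].
    by apply: filterS filterT => q _ i.
  have pn : nbhs p [set q : baire | p n = q n].
    have /(_ [set p n]) := @proj_continuous nat (fun _ => nat) n p.
    move=> h; have := h (discrete_set1 _).
    by apply: filterS => q /= ->.
  apply: filterS (filterI IH pn) => q [a e] i; rewrite ltnS leq_eqVlt.
  by case/orP => [/eqP->//|]; exact: a.
(* The sets containing a cylinder around [p] form a filter. The product topology is a supremum of
   initial topologies, so its convergence to [p] is checked one coordinate at a time. *)
pose F : set_system baire := [set A | exists n, forall q, agree n p q -> A q].
have FF : Filter F.
  split; first by exists 0%N.
    move=> B C [n nB] [m mC]; exists (maxn n m) => q pq; split.
      by apply: nB => i im; apply: pq; rewrite leq_max im.
    by apply: mC => i im; apply: pq; rewrite leq_max im orbT.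
  by move=> B C BC [n nB]; exists n => q /nB /BC.
suff Fp : F --> p by exact: Fp.
apply/cvg_sup => i B [_ [[C oC <-] /= Cpi]] sB.
exists i.+1 => q pq; apply: sB => /=.
by move: Cpi; rewrite /= (pq i (leqnn _)).
Qed.

Lemma agree_mkseq n (p q : baire) : agree n p q -> mkseq p n = mkseq q n.
Proof. by move=> pq; apply/eq_in_map => i; rewrite mem_iota => /pq. Qed.

Lemma mkseq_agree n (p q : baire) : mkseq p n = mkseq q n -> agree n p q.
Proof. by move=> e i i_n; move/(congr1 (nth 0 ^~ i)): e; rewrite !nth_mkseq. Qed.

Lemma continuous_baire (T : topologicalType) (f : T -> baire) :
  (forall t n, nbhs t [set u | f t n = f u n]) -> continuous f.
Proof.
move=> h t A /nbhs_baireP[n nA].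
suff: nbhs t [set u | agree n (f t) (f u)] by apply: filterS => u /nA.
elim: n {nA} => [|n IH]; first by apply: filterS filterT => q _ i.
apply: filterS (filterI IH (h t n)) => u [a e] i; rewrite ltnS leq_eqVlt.
by case/orP => [/eqP->//|]; exact: a.
Qed.

Lemma baire_coord_near (T : topologicalType) (f : T -> baire) t n :
  {for t, continuous f} -> nbhs t [set u | f t n = f u n].
Proof.
move=> cf; have : nbhs (f t) [set q : baire | f t n = q n].
  by apply/nbhs_baireP; exists n.+1 => q; apply.
exact: cf.
Qed.

Lemma nbhs_set_type (X : topologicalType) (D : set X) (x : D) (U : set D) :
  nbhs x U <-> exists2 V, nbhs (set_val x) V & set_val @^-1` V `<=` U.
Proof.
split.
  case=> [_ [[C oC <-] /= Cx] sU]; exists C => //.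
  by apply: open_nbhs_nbhs; split.
case=> V; rewrite nbhsE => -[C [oC Cx] CV] VU.
exists (set_val @^-1` C); split; [by exists C|by []|by move=> y /CV/VU].
Qed.

Lemma open_set_type (X : topologicalType) (D : set X) (U : set D) :
  open U -> exists2 V, open V & set_val @^-1` V = U.
Proof. by []. Qed.

Lemma set_val_continuous (X : topologicalType) (D : set X) :
  continuous (set_val : D -> X).
Proof. exact: initial_continuous. Qed.

Lemma set_valP (X : Type) (D : set X) (x : D) : D (set_val x).
Proof. by rewrite set_valE; apply: set_mem; exact: (valP x). Qed.

Lemma set_val_inj (X : Type) (D : set X) : injective (set_val : D -> X).
Proof. by move=> x y; rewrite set_valE; exact: val_inj. Qed.

Definition to_set (X : Type) (D : set X) (x : X) (h : D x) : D :=
  SigSub (mem_set h).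

Lemma to_setE (X : Type) (D : set X) (x : X) (h : D x) :
  set_val (to_set h) = x.
Proof. by rewrite set_valE. Qed.

Definition restr (T X : Type) (D : set X) (f : T -> X) (h : forall t, D (f t))
  (t : T) : D := SigSub (mem_set (h t)).

Lemma restrE (T X : Type) (D : set X) (f : T -> X) (h : forall t, D (f t)) t :
  set_val (restr h t) = f t.
Proof. by rewrite set_valE. Qed.

Lemma continuous_to_set (T X : topologicalType) (D : set X) (f : T -> D) :
  continuous (fun t => set_val (f t)) -> continuous f.
Proof. exact: continuous_comp_initial. Qed.

Lemma restr_continuous (T X : topologicalType) (D : set X) (f : T -> X)
  (h : forall t, D (f t)) : continuous f -> continuous (restr h).
Proof.
move=> cf; apply: continuous_to_set.
by have -> : (fun t => set_val (restr h t)) = f by apply/funext => t; rewrite restrE.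
Qed.

Lemma compose_continuous (X Y Z : topologicalType) (f : X -> Y) (g : Y -> Z) :
  continuous f -> continuous g -> continuous (fun x => g (f x)).
Proof. by move=> cf cg x; apply: cvg_comp (cf x) (cg (f x)). Qed.

Lemma pair_continuous (X Y Z : topologicalType) (f : X -> Y) (g : X -> Z) :
  continuous f -> continuous g -> continuous (fun x => (f x, g x)).
Proof.
by move=> cf cg x; apply: (@cvg_pair _ _ _ (nbhs x) (nbhs (f x)) (nbhs (g x)));
  [exact: cf|exact: cg].
Qed.

Lemma fst_comp_continuous (X Y Z : topologicalType) (f : X -> Y * Z) :
  continuous f -> continuous (fun x => (f x).1).
Proof. by move=> cf; apply: compose_continuous cf _ => x; exact: cvg_fst. Qed.

Lemma snd_comp_continuous (X Y Z : topologicalType) (f : X -> Y * Z) :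
  continuous f -> continuous (fun x => (f x).2).
Proof. by move=> cf; apply: compose_continuous cf _ => x; exact: cvg_snd. Qed.

Lemma id_continuous (X : topologicalType) : continuous (fun x : X => x).
Proof. by move=> x. Qed.

(** Asking for a whole tail [U m] inside [V] replaces a decreasing base: points chosen in the
    successive [U n] then converge to [t] at once. *)
Definition first_countable (T : topologicalType) := forall t : T,
  exists2 U : nat -> set T, forall n, nbhs t (U n) &
    forall V, nbhs t V -> exists n, forall m, (n <= m)%N -> U m `<=` V.

Lemma first_countable_baire : first_countable baire.
Proof.
move=> p; exists (fun n => [set q | agree n p q]).
  by move=> n; apply/nbhs_baireP; exists n.
move=> V /nbhs_baireP[n nV]; exists n => m nm q pq; apply: nV => i im.
by apply: pq; exact: leq_trans nm.
Qed.

Lemma first_countable_prod (X Y : topologicalType) :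
  first_countable X -> first_countable Y -> first_countable (X * Y)%type.
Proof.
move=> fX fY [x y]; have [U nU bU] := fX x; have [V nV bV] := fY y.
exists (fun n => U n `*` V n).
  by move=> n; exists (U n, V n) => //; split=> /=.
move=> W [[A B] /= [/bU[n nA] /bV[m mB]] AB]; exists (maxn n m) => k.
rewrite geq_max => /andP[nk mk] [a b] [/= Ua Vb]; apply: AB.
by split; [exact: nA Ua|exact: mB Vb].
Qed.

Lemma first_countable_set (X : topologicalType) (D : set X) :
  first_countable X -> first_countable D.
Proof.
move=> fX x; have [U nU bU] := fX (set_val x).
exists (fun n => set_val @^-1` (U n)).
  by move=> n; apply/nbhs_set_type; exists (U n).
move=> V /nbhs_set_type[W /bU[n nW] WV]; exists n => m nm y Uy.
by apply: WV; exact: nW nm _ Uy.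
Qed.

(** * Countable bases and the T0 axiom *)

Lemma basisP (T : topologicalType) (B : set (set T)) :
  B `<=` open -> (forall x U, nbhs x U -> exists A, [/\ B A, A x & A `<=` U]) ->
  basis B.
Proof.
by move=> Bo h; split=> // x U /h[A [BA Ax AU]]; exists A.
Qed.

Lemma basis_nbhs (T : topologicalType) (B : set (set T)) x U :
  basis B -> nbhs x U -> exists A, [/\ B A, A x & A `<=` U].
Proof. by case=> _ h /h[A [BA Ax] AU]; exists A. Qed.

Lemma second_countable_baire : @second_countable baire.
Proof.
pose cyl (s : seq nat) : set baire := [set p | mkseq p (size s) = s].
exists (range cyl).
  by apply: sub_countable (card_image_le _ _) _; exact: countableP.
apply: basisP => [_ [s _ <-]|p U /nbhs_baireP[n nU]].
  rewrite openE => p cp; apply/nbhs_baireP; exists (size s) => q /agree_mkseq.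
  by rewrite /cyl /= cp => <-.
exists (cyl (mkseq p n)); split; first by exists (mkseq p n).
  by rewrite /cyl /= size_mkseq.
by move=> q; rewrite /cyl /= size_mkseq => /esym/mkseq_agree/nU.
Qed.

Lemma second_countable_nat : @second_countable nat.
Proof.
exists (range (fun n : nat => [set n])).
  by apply: sub_countable (card_image_le _ _) _; exact: countableP.
apply: basisP => [_ [n _ <-]|n U nU]; first exact: discrete_open.
exists [set n]; split; [by exists n|by []|].
by move=> _ ->; exact: nbhs_singleton nU.
Qed.

Lemma second_countable_prod (X Y : topologicalType) :
  @second_countable X -> @second_countable Y ->
  @second_countable (X * Y)%type.
Proof.
move=> [B cB bB] [C cC bC].
exists [set P.1 `*` P.2 | P in B `*` C].
  by apply: sub_countable (card_image_le _ _) _; exact: countableX.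
apply: basisP => [_ [[P Q] /= [BP CQ] <-]|[x y] U [[P Q] /= [Px Qy] PQU]].
  rewrite openE => -[x y] [/= Px Qy]; exists (P, Q) => //; split=> /=.
    by apply: open_nbhs_nbhs; split=> //; exact: bB.1.
  by apply: open_nbhs_nbhs; split=> //; exact: bC.1.
have [P' [BP' Px' P'P]] := basis_nbhs bB Px.
have [Q' [BQ' Qy' Q'Q]] := basis_nbhs bC Qy.
exists (P' `*` Q'); split=> //; first by exists (P', Q').
by move=> [a b] [/= /P'P ? /Q'Q ?]; exact: PQU.
Qed.

Lemma second_countable_set (X : topologicalType) (D : set X) :
  @second_countable X -> @second_countable D.
Proof.
move=> [B cB bB]; exists [set (set_val : D -> X) @^-1` P | P in B].
  by apply: sub_countable (card_image_le _ _) cB.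
apply: basisP => [_ [P BP <-]|x U /nbhs_set_type[V /(basis_nbhs bB)]].
  by exists P => //; exact: bB.1.
move=> [P [BP Px PV]] VU; exists (set_val @^-1` P); split=> //.
  by exists P.
by move=> y /PV/VU.
Qed.

Lemma kolmogorovP (T : topologicalType) :
  (forall x y : T, (forall U, open U -> U x <-> U y) -> x = y) ->
  kolmogorov_space T.
Proof.
move=> h x y xy; apply: contrapT => nh; move/eqP: xy; apply; apply: h.
move=> U oU; split=> Uz; apply: contrapT => nU; apply: nh; exists U.
  by left; split; rewrite inE //; apply: open_nbhs_nbhs.
by right; split; rewrite inE //; apply: open_nbhs_nbhs.
Qed.

Lemma kolmogorov_eq (T : topologicalType) (x y : T) : kolmogorov_space T ->
  (forall U, open U -> U x <-> U y) -> x = y.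
Proof.
move=> kT h; apply: contrapT => /eqP /kT[A [] []]; rewrite inE nbhsE.
  by move=> [U [oU Ux] UA]; rewrite inE => nA; apply/nA/UA/(h U oU).
by move=> [U [oU Uy] UA]; rewrite inE => nA; apply/nA/UA/(h U oU).
Qed.

Lemma kolmogorov_inj (X Y : topologicalType) (f : X -> Y) :
  injective f -> continuous f -> kolmogorov_space Y -> kolmogorov_space X.
Proof.
move=> fi /continuousP cf kY; apply: kolmogorovP => x y h; apply: fi.
by apply: kolmogorov_eq kY _ => U oU; exact: (h _ (cf _ oU)).
Qed.

Lemma kolmogorov_prod (X Y : topologicalType) :
  kolmogorov_space X -> kolmogorov_space Y -> kolmogorov_space (X * Y)%type.
Proof.
move=> kX kY; apply: kolmogorovP => -[x y] [x' y'] h.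
congr pair; [apply: kolmogorov_eq kX _|apply: kolmogorov_eq kY _] => U oU.
  apply: (h (fst @^-1` U)); move: U oU; apply/continuousP.
  by move=> ?; exact: cvg_fst.
apply: (h (snd @^-1` U)); move: U oU; apply/continuousP.
by move=> ?; exact: cvg_snd.
Qed.

Lemma hausdorff_baire : hausdorff_space baire.
Proof.
by apply: hausdorff_product => _; exact: discrete_hausdorff.
Qed.

Lemma kolmogorov_baire : kolmogorov_space baire.
Proof.
by apply: accessible_kolmogorov; apply: hausdorff_accessible;
  exact: hausdorff_baire.
Qed.

Lemma qcb0_second_countable (X : topologicalType) :
  kolmogorov_space X -> @second_countable X -> qcb0 X.
Proof.
move=> kX sX; split=> //; exists X, id; split=> //; split=> //.
by apply/seteqP; split=> // x _; exists x.
Qed.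

Lemma qcb0_baire_set (D : set baire) : qcb0 D.
Proof.
apply: qcb0_second_countable.
  apply: (kolmogorov_inj (f := set_val)); last exact: kolmogorov_baire.
    exact: set_val_inj.
  exact: set_val_continuous.
by apply: second_countable_set; exact: second_countable_baire.
Qed.

Lemma qcb0_baire : qcb0 baire.
Proof. exact: qcb0_second_countable kolmogorov_baire second_countable_baire. Qed.

(** * Codes of open sets of the Baire space *)

(** [c.+1] codes the cylinder of the finite sequence with number [c], and [0]
    the empty set, so that the empty union has an enumeration too. *)
Definition hit (c : nat) (d : baire) : bool :=
  if c is c'.+1 then
    if @unpickle (seq nat) c' is Some s then mkseq d (size s) == s else false
  else false.

Arguments hit : simpl never.

Lemma hit_pickle (s : seq nat) d :
  hit (pickle s).+1 d = (mkseq d (size s) == s).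
Proof. by rewrite /hit pickleK. Qed.

Definition enum_open (p : baire) : set baire := [set d | exists i, hit (p i) d].

Lemma hit_local c d : hit c d -> exists n, forall d', agree n d d' -> hit c d'.
Proof.
case: c => // c; rewrite /hit; case: (unpickle c) => // s /eqP <-.
by exists (size s) => d' /agree_mkseq dd'; rewrite size_mkseq dd'.
Qed.

Lemma open_enum_open : open [set z : baire * baire | enum_open z.1 z.2].
Proof.
rewrite openE => -[p d] [i /= hi]; have [n nh] := hit_local hi.
exists ([set p' | agree i.+1 p p'], [set d' | agree n d d']).
  by split; apply/nbhs_baireP; [exists i.+1|exists n].
by move=> [p' d'] [/= pp' dd']; exists i; rewrite -(pp' i) //; exact: nh.
Qed.

Lemma open_enum_openP (p : baire) : open (enum_open p).
Proof.
have /continuousP := pair_continuous (@cst_continuous baire baire p)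
  (@id_continuous baire).
by move/(_ _ open_enum_open).
Qed.

(** Currying of open sets is continuous on codes. Stage [i], read as a pair of finite sequences [u]
    and [v], releases the cylinder of [v] if [s] extends [u] and the box of [u] and [v] lies in [W];
    otherwise it releases the empty set, coded by 0. A stage reads only [size u] values of [s]. *)
Lemma enum_open_param (W : set (baire * baire)) : open W ->
  exists2 g : baire -> baire, continuous g &
    forall s t, enum_open (g s) t <-> W (s, t).
Proof.
move=> oW; pose g s i : nat :=
  if @unpickle (seq nat * seq nat)%type i is Some (u, v) then
    if (mkseq s (size u) == u) && `[< forall s' t', mkseq s' (size u) = u ->
          mkseq t' (size v) = v -> W (s', t') >] then (pickle v).+1 else 0
  else 0.
exists g.
  apply: continuous_baire => s i; rewrite /g.
  case: (@unpickle (seq nat * seq nat)%type i) => [[u v]|]; last first.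
    by apply: filterS filterT.
  apply/nbhs_baireP; exists (size u) => s' /agree_mkseq ss' /=.
  by rewrite ss'.
move=> s t; split=> [[i]|].
  rewrite /g; case: (@unpickle (seq nat * seq nat)%type i) => [[u v]|] //.
  case: ifP => //= /andP[/eqP su /asboolP h].
  by rewrite hit_pickle => /eqP tv; exact: h.
rewrite openE in oW => /oW[[A B] /= [/nbhs_baireP[n nA] /nbhs_baireP[m mB]] AB].
exists (pickle (mkseq s n, mkseq t m)); rewrite /g pickleK !size_mkseq eqxx /=.
rewrite asboolT; first by rewrite hit_pickle size_mkseq.
move=> s' t' /esym/mkseq_agree /nA As' /esym/mkseq_agree /mB Bt'.
exact: AB.
Qed.

Lemma enum_open_surj (O : set baire) : open O ->
  exists p, forall d, enum_open p d <-> O d.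
Proof.
move=> oO.
have oW : open ((snd : baire * baire -> baire) @^-1` O).
  by move: O oO; apply/continuousP => z; exact: cvg_snd.
have [g _ gE] := enum_open_param oW.
by exists (g (fun=> 0)) => d; rewrite gE.
Qed.

(** * Pairing and countable tupling of sequences *)

Definition pairb (p q : baire) : baire :=
  fun n => if odd n then q n./2 else p n./2.
Definition fstb (r : baire) : baire := fun n => r n.*2.
Definition sndb (r : baire) : baire := fun n => r n.*2.+1.
Definition rowb (n : nat) (r : baire) : baire := fun m => r (pickle (n, m)).
Definition tailb (r : baire) : baire := fun n => r n.+1.
Definition consb (n : nat) (r : baire) : baire :=
  fun i => if i is i'.+1 then r i' else n.

Lemma pairbK1 p q : fstb (pairb p q) = p.
Proof. by apply/funext => n; rewrite /fstb /pairb odd_double doubleK. Qed.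

Lemma pairbK2 p q : sndb (pairb p q) = q.
Proof.
by apply/funext => n; rewrite /sndb /pairb /= odd_double /= uphalf_double.
Qed.

Lemma consbK n r : tailb (consb n r) = r.
Proof. by apply/funext. Qed.

Definition table (f : nat -> baire) : baire := fun i =>
  if @unpickle (nat * nat)%type i is Some (n, m) then f n m else 0.

Lemma precomp_continuous (h : nat -> nat) :
  continuous ((fun r : baire => (fun n => r (h n))) : baire -> baire).
Proof.
apply: continuous_baire => r n; apply/nbhs_baireP.
by exists (h n).+1 => s; apply.
Qed.

Lemma fstb_continuous : continuous fstb.
Proof. exact: precomp_continuous. Qed.

Lemma sndb_continuous : continuous sndb.
Proof. exact: precomp_continuous. Qed.

Lemma rowb_continuous n : continuous (rowb n).
Proof. exact: precomp_continuous. Qed.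

Lemma tailb_continuous : continuous tailb.
Proof. exact: precomp_continuous. Qed.

Lemma consb_continuous n : continuous (consb n).
Proof.
apply: continuous_baire => r [|i]; first by apply: filterS filterT.
by apply/nbhs_baireP; exists i.+1 => s; apply.
Qed.

Lemma pairb_continuous (T : topologicalType) (f g : T -> baire) :
  continuous f -> continuous g -> continuous (fun t => pairb (f t) (g t)).
Proof.
move=> cf cg; apply: continuous_baire => t n.
have nf := baire_coord_near n./2 (cf t).
have ng := baire_coord_near n./2 (cg t).
by apply: filterS (filterI nf ng) => u [/= e1 e2]; rewrite /pairb e1 e2.
Qed.

Lemma table_continuous (T : topologicalType) (f : nat -> T -> baire) :
  (forall n, continuous (f n)) ->
  continuous (fun t => table (fun n => f n t)).
Proof.
move=> cf; apply: continuous_baire => t i; rewrite /table.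
case: (@unpickle (nat * nat)%type i) => [[n m]|]; last by apply: filterS filterT.
exact: baire_coord_near (cf n t).
Qed.

Lemma rowb_table f n : rowb n (table f) = f n.
Proof. by apply/funext => m; rewrite /rowb /table pickleK. Qed.

(** * Representations as relations *)

Definition total_rep (X : Type) (R : baire -> X -> Prop) :=
  forall x, exists p, R p x.

(** Continuity and finality of a representation in one condition. Single-valuedness is not imposed:
    in a T0 space it follows, since two points with a common name lie in the same open sets. *)
Definition quotient_rep (X : topologicalType) (R : baire -> X -> Prop) :=
  forall U : set X, open U <->
    exists2 O : set baire, open O & forall p x, R p x -> (O p <-> U x).

(** A convergent sequence of parameters together with its limit is compact, so
    quantifying universally over it preserves openness, although the product of
    a quotient map with an identity need not be a quotient map. *)
Lemma probe_open (X T : topologicalType) (R : baire -> X -> Prop)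
    (C : set baire) (W : X -> baire -> Prop) (O : set (baire * baire))
    (nu : T -> X) (beta : T -> baire) :
  total_rep R -> quotient_rep R -> first_countable T -> open O ->
  (forall p x b, R p x -> C b -> (O (p, b) <-> W x b)) ->
  continuous nu -> continuous beta -> (forall t, C (beta t)) ->
  open [set t | W (nu t) (beta t)].
Proof.
move=> tR qR fT oO OW cnu cbeta Cb; rewrite openE => t0 /= Wt0.
apply: contrapT => nW; have [U nU bU] := fT t0.
(* If the set is not a neighbourhood of [t0], some sequence converging to [t0] avoids it
   entirely. *)
have /choice[t tP] : forall n, exists t, U n t /\ ~ W (nu t) (beta t).
  move=> n; apply: contrapT => h; apply: nW; apply: filterS (nU n) => t Ut.
  by apply: contrapT => nWt; apply: h; exists t.
have beta_near B : nbhs (beta t0) B -> exists k, forall n, (k <= n)%N ->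
    B (beta (t n)).
  move=> /cbeta /bU[k kB]; exists k => n /kB; apply.
  by case: (tP n).
have [p0 Rp0] := tR (nu t0).
have rect p b : O (p, b) -> exists A B,
    [/\ nbhs p A, nbhs b B & forall p' b', A p' -> B b' -> O (p', b')].
  move: oO; rewrite openE => /(_ (p, b)) /[apply] -[[A B] /= [nA nB] AB].
  by exists A, B; split=> // p' b' Ap Bb; exact: AB.
have [A [B [/nbhs_singleton Ap0 /beta_near[k kB] AB]]] :=
  rect _ _ ((OW _ _ _ Rp0 (Cb t0)).2 Wt0).
(* [G] quantifies over the tail of the sequence of parameters together with its limit. It is a
   subset of [X] alone, so the quotient property decides whether it is open. *)
pose G := [set x | W x (beta t0) /\
  forall n, (k <= n)%N -> W x (beta (t n))].
have oG : open G.
  apply/qR; exists [set p | O (p, beta t0) /\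
      forall n, (k <= n)%N -> O (p, beta (t n))]; last first.
    move=> p x Rpx; split=> -[h0 h1]; split.
    - exact/(OW _ _ _ Rpx (Cb t0)).
    - by move=> n /h1 /(OW _ _ _ Rpx (Cb (t n))).
    - exact/(OW _ _ _ Rpx (Cb t0)).
    - by move=> n /h1 /(OW _ _ _ Rpx (Cb (t n))).
  (* A box around the limit parameter takes care of all [n] from [j] on; the finitely many others
     are handled by a finite intersection. *)
  rewrite openE => p [h0 h1].
  have [A' [B' [nA' nB' AB']]] := rect _ _ h0.
  have [j jB'] := beta_near _ nB'.
  have nF : nbhs p [set q | forall n, (n < j)%N -> (k <= n)%N ->
      O (q, beta (t n))].
    elim: j {jB'} => [|j IH]; first by apply: filterS filterT => q _ n.
    have nj : nbhs p [set q | (k <= j)%N -> O (q, beta (t j))].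
      have [kj|_] := boolP (k <= j)%N; last by apply: filterS filterT.
      have [A2 [B2 [nA2 /nbhs_singleton B2t h2]]] := rect _ _ (h1 _ kj).
      by apply: filterS nA2 => q A2q _; exact: h2.
    apply: filterS (filterI IH nj) => q [a e] n; rewrite ltnS leq_eqVlt.
    by case/orP => [/eqP->//|]; exact: a.
  apply: filterS (filterI nA' nF) => q [A'q Fq]; split.
    by apply: AB' A'q _; exact: nbhs_singleton nB'.
  move=> n kn; have [nj|jn] := ltnP n j; first exact: Fq.
  by apply: AB' A'q _; exact: jB'.
have nG : nbhs (nu t0) G.
  apply: open_nbhs_nbhs; split=> //; split=> // n kn.
  by apply/(OW _ _ _ Rp0 (Cb _)); apply: AB => //; exact: kB.
have [j jG] := bU _ (cnu _ _ nG).
have [Ut nWt] := tP (maxn j k).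
have [_ /(_ (maxn j k))] := jG _ (leq_maxl _ _) _ Ut.
by rewrite leq_maxr => /(_ isT).
Qed.

(** * The hyperprojective hierarchy *)

Section well_orders.
Context {d : Order.disp_t} {W : orderType d}.
Hypothesis wfW : well_founded (fun v w : W => (v < w)%O).

Lemma wf_min (P : set W) : P !=set0 ->
  exists2 w, P w & forall v, P v -> (w <= v)%O.
Proof.
move=> [w0 Pw0]; apply: contrapT => h.
elim/(well_founded_ind wfW): w0 Pw0 => w IH Pw; apply: h; exists w => // v Pv.
by rewrite leNgt; apply/negP => /IH; exact.
Qed.

Lemma wo_succ_ex (v w : W) : (v < w)%O ->
  exists s, wo_succ v s /\ (s <= w)%O.
Proof.
move=> vw; have [|s vs smin] := @wf_min [set s | (v < s)%O]; first by exists w.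
exists s; split; last exact: smin.
by split=> // u us; rewrite leNgt; apply/negP => /smin; rewrite leNgt us.
Qed.

Lemma wo_cases (w : W) :
  [\/ wo_zero w, exists v, wo_succ v w | wo_limit w].
Proof.
have [w0|w0] := pselect (wo_zero w); first exact: Or31.
have [ws|ws] := pselect (exists v, wo_succ v w); first exact: Or32.
by apply: Or33; split=> // v vw; apply: ws; exists v.
Qed.

Lemma wo_limit_succ (v w : W) : wo_limit w -> (v < w)%O ->
  exists s, wo_succ v s /\ (s < w)%O.
Proof.
move=> [_ lw] /[dup] vw /wo_succ_ex[s [vs]]; rewrite le_eqVlt => /orP[/eqP e|].
  by move: vs; rewrite e => /lw.
by exists s.
Qed.

Lemma preimage_closed_Sigma1_at (w : W) :
  preimage_closed (Sigma1_at wfW w).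
Proof.
elim/(well_founded_ind wfW): w => w IH.
have [w0|[v vw]|lw] := wo_cases w.
- by rewrite Sigma1_at_zero //; exact: preimage_closed_Sigma10.
- rewrite (Sigma1_at_succ wfW vw); apply: preimage_closed_exists.
  by apply: preimage_closed_compl; apply: IH; exact: vw.1.
- rewrite (Sigma1_at_limit wfW lw); apply: preimage_closed_exists.
  apply: preimage_closed_delta => X Y f A cf [v vw SA].
  by exists v => //; exact: IH SA.
Qed.

Lemma pc_exists_subset (G G' : pointclasses) X :
  (forall Y, G Y `<=` G' Y) -> @pc_exists G X `<=` @pc_exists G' X.
Proof. by move=> GG' _ [A GA <-]; exists A => //; exact: GG'. Qed.

Lemma pc_compl_subset (G G' : pointclasses) X :
  (forall Y, G Y `<=` G' Y) -> @pc_compl G X `<=` @pc_compl G' X.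
Proof. by move=> GG' _ [A GA <-]; exists A => //; exact: GG'. Qed.

Lemma pc_delta_subset (G G' : pointclasses) X :
  (forall Y, G Y `<=` G' Y) -> @pc_delta G X `<=` @pc_delta G' X.
Proof. by move=> GG' _ [A GA ->]; exists A => // n; exact: GG'. Qed.

Lemma pc_exists_dummy (G : pointclasses) (X : topologicalType) (A : set X) :
  preimage_closed G -> G X A -> pc_exists G A.
Proof.
move=> pG GA; exists (snd @^-1` A).
  by apply: pG GA => z; exact: cvg_snd.
by apply/seteqP; split=> [x []//|x Ax]; exists (fun=> 0).
Qed.

(** The two claims are proved together because the complement in the successor step exchanges them.
    The clopen sets of interest fix the first value of a quantified sequence, which is how countable
    unions are absorbed into the quantifier. *)
Lemma Sigma1_at_clopen (w : W) (X : topologicalType) (A K : set X) :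
  open K -> open (~` K) -> Sigma1_at wfW w A ->
  Sigma1_at wfW w (A `&` K) /\ Sigma1_at wfW w (A `|` K).
Proof.
elim/(well_founded_ind wfW): w => w IH in X A K *.
have osnd (Y : topologicalType) (B : set Y) : open B ->
    open ((snd : baire * Y -> Y) @^-1` B).
  by move: B; apply/continuousP => z; exact: cvg_snd.
move=> oK oK'; have [w0|[v vw]|lw] := wo_cases w.
- rewrite Sigma1_at_zero // => -[U [V [oU oV ->]]]; split.
    exists (fun n => U n `&` K), V; split=> // [n|]; first exact: openI.
    apply/seteqP; split=> [x [[n _ [Ux nV]] Kx]|x [n _ [[Ux Kx] nV]]].
      by exists n.
    by split=> //; exists n.
  exists (fun n => if n is n'.+1 then U n' else K),
    (fun n => if n is n'.+1 then V n' else set0).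
  split=> [[]//|[|n]//|]; first exact: open0.
  apply/seteqP; split=> [x [[n _ h]|Kx]|x [[|n] _ /= h]].
  + by exists n.+1.
  + by exists 0%N => //; split=> // -[].
  + by right; case: h.
  + by left; exists n.
- rewrite (Sigma1_at_succ wfW vw) => -[_ [B SB <-] <-]; split.
    exists (~` (B `|` snd @^-1` (~` K))).
      eexists; last by []; apply: (IH v vw.1 _ _ _ _ _ SB).2; first exact: osnd.
      by rewrite -preimage_setC setCK; exact: osnd.
    apply/seteqP; split=> [x [p /= nB]|x [[p nB] Kx]].
      split; first by exists p => Bp; apply: nB; left.
      by apply: contrapT => nK; apply: nB; right.
    by exists p => -[].
  exists (~` (B `&` snd @^-1` (~` K))).
    eexists; last by []; apply: (IH v vw.1 _ _ _ _ _ SB).1; first exact: osnd.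
    by rewrite -preimage_setC setCK; exact: osnd.
  apply/seteqP; split=> [x [p /= nB]|x [[p nB]|Kx]].
  + have [Kx|nK] := pselect (K x); first by right.
    by left; exists p => Bp; exact: nB.
  + by exists p => -[].
  + by exists (fun=> 0) => -[].
- rewrite (Sigma1_at_limit wfW lw) => -[_ [B SB ->] <-]; split.
    exists (\bigcap_n (B n `&` snd @^-1` K)).
      eexists; last by []; move=> n; have [v vw SBn] := SB n; exists v => //.
      apply: (IH v vw _ _ _ _ _ SBn).1; first exact: osnd.
      exact: osnd oK'.
    apply/seteqP; split=> [x [p /= h]|x [[p h] Kx]].
      split; last by have [] := h 0%N I.
      by exists p => n _; have [] := h n I.
    by exists p => n _; split=> //; exact: h.
  exists (\bigcap_n (B n `|` snd @^-1` K)).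
    eexists; last by []; move=> n; have [v vw SBn] := SB n; exists v => //.
    apply: (IH v vw _ _ _ _ _ SBn).2; first exact: osnd.
    exact: osnd oK'.
  apply/seteqP; split=> [x [p /= h]|x [[p h]|Kx]].
  + have [Kx|nK] := pselect (K x); first by right.
    by left; exists p => n _; case: (h n I).
  + by exists p => n _; left; exact: h.
  + by exists (fun=> 0) => n _; right.
Qed.

Lemma coord_clopen (X : topologicalType) (n : nat) :
  let K := [set z : baire * X | z.1 0 = n] in open K /\ open (~` K).
Proof.
have co (U : set nat) : open [set z : baire * X | U (z.1 0)].
  rewrite openE => -[p x] /= Up.
  exists ([set q : baire | p 0 = q 0], setT) => /=; last first.
    by move=> [q y] [/= e _]; rewrite -e.
  by split; [apply/nbhs_baireP; exists 1%N => q; exact|exact: filterT].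
by split; [exact: (co [set n])|exact: (co [set~ n])].
Qed.

(** The witness [p] selects by [p 0] the difference that contains [x]. The ways to fail, missing
    [U n] or meeting [V n] for [n = p 0], form a countable union of differences of open sets, with
    the two families interleaved by parity. *)
Lemma Sigma10_exists_compl (X : topologicalType) (A : set X) :
  Sigma10 A -> pc_exists (pc_compl Sigma10) A.
Proof.
case=> U [V [oU oV ->]].
pose K n := [set z : baire * X | z.1 0 = n].
have osnd (B : set X) : open B -> open ((snd : baire * X -> X) @^-1` B).
  by move: B; apply/continuousP => z; exact: cvg_snd.
exists (~` ((\bigcup_n (K n `\` snd @^-1` U n)) `|`
            (\bigcup_n ((K n `&` snd @^-1` V n) `\` set0)))).
  eexists; last by [].
  exists (fun n => if odd n then K n./2 `&` snd @^-1` V n./2 else K n./2),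
    (fun n => if odd n then set0 else snd @^-1` U n./2).
  split=> [n|n|].
  - have [oK _] := coord_clopen X n./2; case: (odd n) => //.
    by apply: openI => //; exact: osnd.
  - by case: (odd n); [exact: open0|exact: osnd].
  - apply/seteqP; split=> [z [[n _ h]|[n _ h]]|z [n _]].
    + by exists n.*2 => //; rewrite odd_double doubleK.
    + by exists n.*2.+1 => //; rewrite /= odd_double /= uphalf_double.
    + by case: (odd n) => h; [right|left]; exists n./2.
apply/seteqP; split=> [x [p /= h]|x [n _ [Ux nVx]]].
  exists (p 0) => //; split.
    by apply: contrapT => nU; apply: h; left; exists (p 0).
  by move=> Vx; apply: h; right; exists (p 0) => //; split=> // -[].
exists (fun=> n) => -[[m _ [/= <-]]//|[m _ [[/= <-]]]//].
Qed.

(** At a limit, the complement of the intersection of the [A n] is a union whose index can be stored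
    in [p 0]. The condition that [p 0 = n] excludes membership in [A n] lies one level above [A n],
    and that level is still below the limit. *)
Lemma Sigma1_at_exists_compl (w : W) X :
  @Sigma1_at _ _ wfW w X `<=` @pc_exists (pc_compl (Sigma1_at wfW w)) X.
Proof.
elim/(well_founded_ind wfW): w => w IH in X *.
have [w0|[v vw]|lw] := wo_cases w.
- by rewrite Sigma1_at_zero //; exact: Sigma10_exists_compl.
- rewrite (Sigma1_at_succ wfW vw); apply: pc_exists_subset => Y.
  apply: pc_compl_subset => {}Y; exact: IH vw.1 _.
- rewrite (Sigma1_at_limit wfW lw); apply: pc_exists_subset => Y.
  move=> _ [A SA ->]; exists (\bigcup_n ~` A n); last first.
    apply/seteqP; split=> [y ny n _|y h [n _]]; last by apply; exact: h.
    by apply: contrapT => nA; apply: ny; exists n.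
  pose K n := [set z : baire * Y | z.1 0 = n].
  exists (\bigcap_n (~` ((snd @^-1` A n) `&` K n))).
    exists (fun n => ~` ((snd @^-1` A n) `&` K n)) => // n; have [v vw SAn] := SA n.
    have [s [vs sw]] := wo_limit_succ lw vw; exists s => //=.
    rewrite (Sigma1_at_succ wfW vs); apply: pc_exists_dummy.
      apply: preimage_closed_compl; exact: preimage_closed_Sigma1_at.
    exists ((snd @^-1` A n) `&` K n) => //.
    have [oK oK'] := coord_clopen Y n.
    apply: (Sigma1_at_clopen _ _ _).1 => //.
    by apply: preimage_closed_Sigma1_at SAn => z; exact: cvg_snd.
  apply/seteqP; split=> [y [p /= h]|y [n _ nA]].
    by exists (p 0) => // Ay; exact: (h (p 0) I).
  by exists (fun=> n) => m _ [/= Am e]; apply: nA; rewrite /K /= in e; rewrite e.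
Qed.

Lemma Sigma1_at_le (v w : W) X : (v <= w)%O ->
  @Sigma1_at _ _ wfW v X `<=` @Sigma1_at _ _ wfW w X.
Proof.
elim/(well_founded_ind wfW): w => w IH in X *.
rewrite le_eqVlt => /orP[/eqP->//|vw].
have [w0|[u uw]|lw] := wo_cases w.
- by have := w0 v; rewrite leNgt vw.
- apply: subset_trans (IH u uw.1 _ (uw.2 _ vw)) _.
  by rewrite (Sigma1_at_succ wfW uw); exact: Sigma1_at_exists_compl.
- rewrite (Sigma1_at_limit wfW lw) => A SA.
  exists (\bigcap_(n in [set: nat]) (snd @^-1` A)).
    exists (fun=> snd @^-1` A) => // n; exists v => //.
    by apply: preimage_closed_Sigma1_at SA => z; exact: cvg_snd.
  by apply/seteqP; split=> [x [p /(_ 0%N I)]//|x Ax]; exists (fun=> 0).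
Qed.

Lemma Sigma10_le (w : W) X : @Sigma10 X `<=` @Sigma1_at _ _ wfW w X.
Proof.
have [|z _ z0] := @wf_min setT; first by exists w.
have zz : wo_zero z by move=> v; exact: z0.
by rewrite -(Sigma1_at_zero wfW zz); apply: Sigma1_at_le; exact: z0.
Qed.

End well_orders.

(** * Comparison of levels over different well-orders *)

Section well_order_comparison.
Context {d1 d2 : Order.disp_t} {W1 : orderType d1} {W2 : orderType d2}.
Hypothesis wf1 : well_founded (fun v w : W1 => (v < w)%O).
Hypothesis wf2 : well_founded (fun v w : W2 => (v < w)%O).

(** [rank_le w v]: the order type below [w] is at most the one below [v]. *)
Inductive rank_le (w : W1) (v : W2) : Prop :=
  RankLe of forall u, (u < w)%O -> exists t, (t < v)%O /\ rank_le u t.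

Lemma rank_leP w v : rank_le w v ->
  forall u, (u < w)%O -> exists t, (t < v)%O /\ rank_le u t.
Proof. by case. Qed.

(** A limit [w] may be dominated by an index [v] that is not a limit, so [v] is first lowered to the
    least dominating [v']. This one is a limit: if it were the successor of [s], then [s] would
    dominate [w] already, because every [u] below [w] has a successor below [w]. *)
Lemma Sigma1_at_rank_le w v X : rank_le w v ->
  @Sigma1_at _ _ wf1 w X `<=` @Sigma1_at _ _ wf2 v X.
Proof.
elim/(well_founded_ind wf1): w => w IH in v X *.
have [w0|[u uw]|lw] := wo_cases w => wv.
- by rewrite Sigma1_at_zero //; exact: Sigma10_le.
- have [t [tv ut]] := rank_leP wv uw.1.
  have [s [ts sv]] := wo_succ_ex wf2 tv.
  suff h : @Sigma1_at _ _ wf1 w X `<=` @Sigma1_at _ _ wf2 s X.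
    by move=> A /h; exact: Sigma1_at_le sv _.
  rewrite (Sigma1_at_succ wf1 uw) (Sigma1_at_succ wf2 ts).
  apply: pc_exists_subset => Y; apply: pc_compl_subset => {}Y.
  by apply: IH => //; exact: uw.1.
- have [|v' wv' v'min] := @wf_min _ _ wf2 [set v' | rank_le w v'].
    by exists v.
  suff h : @Sigma1_at _ _ wf1 w X `<=` @Sigma1_at _ _ wf2 v' X.
    by move=> A /h; exact: Sigma1_at_le (v'min _ wv) _.
  have lv' : wo_limit v'.
    split=> [v0|s sv'].
      apply: lw.1 => u; rewrite leNgt; apply/negP => /(rank_leP wv')[t [tv' _]].
      by have := v0 t; rewrite leNgt tv'.
    suff : rank_le w s by move/v'min; rewrite leNgt sv'.1.
    constructor=> u /(wo_limit_succ wf1 lw)[u' [uu' u'w]].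
    have [t [tv' u't]] := rank_leP wv' u'w.
    have [t' [t't ut']] := rank_leP u't uu'.1.
    by exists t'; split=> //; apply: lt_le_trans t't _; exact: sv'.2.
  rewrite (Sigma1_at_limit wf1 lw) (Sigma1_at_limit wf2 lv').
  apply: pc_exists_subset => Y; apply: pc_delta_subset => {}Y A [u uw SA].
  have [t [tv' ut]] := rank_leP wv' uw.
  by exists t => //; exact: IH SA.
Qed.

End well_order_comparison.

(** * Countable suprema of countable ordinals *)

Section ordinal_sum.
Variable a : nat -> countable_ordinal.

(** The ordinal sum of all the types, ordered lexicographically, with [None] added as a greatest
    element above every summand. *)
Definition osum := option {n : nat & co_type (a n)}.

HB.instance Definition _ := gen_eqMixin osum.
HB.instance Definition _ := gen_choiceMixin osum.

Definition osum_lt_prop (x y : osum) : Prop :=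
  match x, y with
  | Some u, Some v => (tag u < tag v)%N \/
      tag u = tag v /\ (tagged u < tagged_as u v)%O
  | Some _, None => True
  | None, _ => False
  end.

Definition osum_lt (x y : osum) : bool := `[< osum_lt_prop x y >].

Lemma osum_lt_irr : irreflexive osum_lt.
Proof.
case=> [[n u]|]; apply/asboolP => //= -[]; first by rewrite ltnn.
by rewrite tagged_asE ltxx => -[].
Qed.

Lemma osum_lt_trans : transitive osum_lt.
Proof.
case=> [[n u]|] [[m v]|] [[k w]|] // /asboolP vu /asboolP uw;
  apply/asboolP => //=; move: vu uw => /=.
case=> [mn|[mn]].
  case=> [nk|[nk _]]; left; first exact: ltn_trans mn nk.
  by rewrite -nk.
move: mn => /= mn; rewrite -{n}mn in u *.
rewrite tagged_asE => vu [mk|[/= mk]]; first by left.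
rewrite -{k}mk in w *; rewrite tagged_asE => uw; right; split=> //.
by rewrite tagged_asE; exact: lt_trans vu uw.
Qed.

HB.instance Definition _ := Order.Lt_isPOrder.Build (Order.Disp tt tt) osum
  osum_lt_irr osum_lt_trans.

Lemma osum_ltE (x y : osum) : (x < y)%O = osum_lt x y.
Proof. by []. Qed.

Lemma osum_ltP (x y : osum) : reflect (osum_lt_prop x y) (x < y)%O.
Proof. by rewrite osum_ltE; exact: asboolP. Qed.

Lemma osum_total : total (<=%O : rel osum).
Proof.
move=> x y; rewrite !le_eqVlt !osum_ltE.
have [->|/eqP xy] := eqVneq x y; first by [].

suff : osum_lt x y \/ osum_lt y x by case=> ->; rewrite ?orbT.
case: x y xy => [[n u]|] [[m v]|] xy.
- have [nm|mn|nm] := ltngtP n m; first by left; apply/asboolP; left.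
    by right; apply/asboolP; left.
  rewrite -{m}nm in v xy *.
  have [uv|vu|uv] := ltgtP u v.
  + by left; apply/asboolP; right; rewrite tagged_asE.
  + by right; apply/asboolP; right; rewrite tagged_asE.
  + by case: xy; rewrite uv.
- by left; apply/asboolP.
- by right; apply/asboolP.
- by [].
Qed.

HB.instance Definition _ :=
  Order.POrder_isTotal.Build (Order.Disp tt tt) osum osum_total.

Definition oinj n (u : co_type (a n)) : osum :=
  Some (Tagged (fun n => co_type (a n)) u).

Lemma oinj_top n u : (@oinj n u < None :> osum)%O.
Proof. exact/osum_ltP. Qed.

Lemma oinj_lt n (u v : co_type (a n)) : (u < v)%O -> (oinj u < oinj v)%O.
Proof. by move=> uv; apply/osum_ltP; right; rewrite tagged_asE. Qed.

Lemma osum_wf : well_founded (fun v w : osum => (v < w)%O).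
Proof.
have accS n (u : co_type (a n)) : Acc (fun v w : osum => (v < w)%O) (oinj u).
  elim/ltn_ind: n u => n IHn u; elim/(well_founded_ind (@co_wf (a n))): u.
  move=> u IHu.
  apply: Acc_intro.
  case=> [[m v]|].
    move=> /osum_ltP.
    case=> [mn|[mn]].
      exact: (IHn _ mn v).
    move: mn => /= mn.
    rewrite -{n}mn in u IHn IHu *.
    rewrite tagged_asE.
    exact: IHu.
  by move=> /osum_ltP.
case=> [[n u]|]; first exact: accS.
by constructor=> -[[n u] _|/osum_ltP//]; exact: accS.
Qed.

Lemma osum_countable : countable [set: osum].
Proof.
have H : forall n, exists e : co_type (a n) -> nat, injective e.
  move=> n; have /countable_injP[e einj] := @co_countable (a n).
  by exists e => u v; apply: einj; rewrite inE.
pose e n := sval (cid (H n)); have eP n : injective (e n) := svalP (cid (H n)).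
apply/countable_injP.
exists (fun x : osum => if x is Some u then
  (pickle (tag u, e (tag u) (tagged u))).+1 else 0).
move=> [[n u]|] [[m v]|] _ _ //= [] /(pcan_inj pickleK)[nm].
by move: nm v => <- v /eP ->.
Qed.

Definition ordinal_sum (x : osum) : countable_ordinal :=
  @CountableOrdinal _ osum osum_countable osum_wf x.

Lemma rank_le_oinj n (u : co_type (a n)) : rank_le u (oinj u).
Proof.
elim/(well_founded_ind (@co_wf (a n))): u => u IH; constructor=> v vu.
by exists (oinj v); split; [exact: oinj_lt|exact: IH].
Qed.

(** Every summand is inhabited by its [co_point], so above any element below the top there is one in
    the next summand. *)
Lemma osum_top_limit : wo_limit (None : osum).
Proof.
split=> [/(_ (oinj (co_point (a 0))))|[[n u]|] []]; last by rewrite ltxx.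
  by rewrite leNgt oinj_top.
move=> _ /(_ (oinj (co_point (a n.+1))) (oinj_top _)); rewrite leNgt.
by move/negP; apply; apply/osum_ltP; left => /=.
Qed.

End ordinal_sum.

(** * Closure properties of hyperprojective sets *)

Definition hp (X : topologicalType) (A : set X) := exists alpha, Sigma1 alpha A.

Section hyperprojective_sets.
Variable X : topologicalType.
Implicit Types A B : set X.

Lemma hp_preimage (Y : topologicalType) (f : Y -> X) A :
  continuous f -> hp A -> hp (f @^-1` A).
Proof.
by move=> cf [alpha SA]; exists alpha; exact: preimage_closed_Sigma1 SA.
Qed.

Lemma hp_exists_compl (A : set (baire * X)) : hp A ->
  hp [set x | exists p, ~ A (p, x)].
Proof.
(* [co_point alpha] may be the greatest element of its type. Moved into an ordinal sum it lies below
   the top, hence has a successor. *)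
case=> alpha SA; pose a (_ : nat) := alpha.
have SA' : Sigma1_at (@osum_wf a) (@oinj a 0 (co_point alpha)) A.
  exact: (Sigma1_at_rank_le (wf1 := @co_wf alpha) _ (@rank_le_oinj a 0 _)) SA.
have [s [us _]] := wo_succ_ex (@osum_wf a)
  (oinj_top (co_point alpha : co_type (a 0))).
exists (@ordinal_sum a s); rewrite /Sigma1 /= (Sigma1_at_succ _ us).
by exists (~` A) => //; exists A.
Qed.

(** The top of the ordinal sum of the chosen indices is a limit above all of them, so the limit
    clause of the hierarchy applies. *)
Lemma hp_exists_bigcap (A : nat -> set (baire * X)) : (forall n, hp (A n)) ->
  hp [set x | exists p, forall n, A n (p, x)].
Proof.
move=> /choice[a aP]; exists (@ordinal_sum a None).
rewrite /Sigma1 /= (Sigma1_at_limit _ (@osum_top_limit a)).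
exists (\bigcap_n A n); last first.
  by apply/seteqP; split=> x [p pA]; exists p => n; [exact: pA|move=> _].
exists A => // n; exists (oinj (co_point (a n))); first exact: oinj_top.
exact: (Sigma1_at_rank_le (wf1 := @co_wf (a n)) _ (rank_le_oinj _)) (aP n).
Qed.

End hyperprojective_sets.

Lemma countable_ordinal_nat : countable_ordinal.
Proof.
have wf : well_founded (fun v w : nat => (v < w)%O).
  by elim/ltn_ind => n IH; constructor=> m; rewrite ltEnat; exact: IH.
exact: (@CountableOrdinal _ nat (countableP _) wf 0%N).
Qed.

Lemma countable_enumeration (I : Type) : countable [set: I] ->
  [set: I] = set0 \/ exists f : nat -> I, forall i, exists n, f n = i.
Proof.
move=> /countable_injP[e einj].
have [[i0 _]|n0] := pselect (exists _ : I, True); last first.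
  by left; apply/seteqP; split=> // i _; apply: n0; exists i.
right; have /choice[f fP] : forall n, exists i : I,
    (exists j, e j = n) -> e i = n.
  move=> n; have [[j ej]|nj] := pselect (exists j, e j = n).
    by exists j.
  by exists i0.
exists f => i; exists (e i); apply: einj; rewrite ?inE //.
by apply: fP; exists i.
Qed.

(** * Hyperprojective sets under the logical connectives *)

Section hyperprojective_calculus.
Variable X : topologicalType.
Implicit Types (A B : set X) (P Q : X -> Prop).

Lemma hp_ext P Q : (forall x, P x <-> Q x) -> hp [set x | P x] ->
  hp [set x | Q x].
Proof.
by move=> PQ; have -> : P = Q by apply/funext => x; apply/propext.
Qed.

Lemma hp_open A : open A -> hp A.
Proof.
move=> oA; exists countable_ordinal_nat; apply: Sigma10_le.
exists (fun=> A), (fun=> set0); split=> // [_|]; first exact: open0.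
by apply/seteqP; split=> [x Ax|x [_ _ [Ax _]]//]; exists 0%N => //; split.
Qed.

Lemma hp_not P : hp [set x | P x] -> hp [set x | ~ P x].
Proof.
move=> hP; apply: (hp_ext _ (hp_exists_compl (hp_preimage
  (@snd_comp_continuous _ _ _ _ (@id_continuous (baire * X)%type)) hP))) => x.
by split=> [[p]//|nPx]; exists (fun=> 0).
Qed.

Lemma hp_snd (P : X -> Prop) : hp [set x | P x] ->
  hp [set z : baire * X | P z.2].
Proof.
exact: (hp_preimage
  (@snd_comp_continuous _ _ _ _ (@id_continuous (baire * X)%type))).
Qed.

Lemma hp_forall_nat (P : nat -> X -> Prop) : (forall n, hp [set x | P n x]) ->
  hp [set x | forall n, P n x].
Proof.
move=> hP; apply: (hp_ext _ (hp_exists_bigcap (fun n => hp_snd (hP n)))) => x.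
by split=> [[p]//|Px]; exists (fun=> 0).
Qed.

Lemma hp_ex (P : baire -> X -> Prop) :
  hp [set z : baire * X | P z.1 z.2] -> hp [set x | exists p, P p x].
Proof.
move=> hP; apply: (hp_ext _ (hp_exists_bigcap (fun _ : nat => hP))) => x.
by split=> [[p /(_ 0%N) Pp]|[p Pp]]; exists p.
Qed.

End hyperprojective_calculus.

Lemma hp_cst (X : topologicalType) (P : Prop) : hp [set x : X | P].
Proof.
have [p|np] := pselect P; apply: hp_open.
  by have -> : [set x : X | P] = setT; [apply/seteqP; split|exact: openT].
by have -> : [set x : X | P] = set0; [apply/seteqP; split=> // ? /np|exact: open0].
Qed.

Section hyperprojective_formulas.
Variable X : topologicalType.
Implicit Types (A B : set X) (P Q : X -> Prop).

Lemma hp_and P Q : hp [set x | P x] -> hp [set x | Q x] ->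
  hp [set x | P x /\ Q x].
Proof.
move=> hP hQ.
apply: (hp_ext (P := fun x => forall n : nat, if n is 0 then P x else Q x)).
  by move=> x; split=> [h|[Px Qx] []//]; split; [exact: h 0%N|exact: h 1%N].
by apply: hp_forall_nat => -[].
Qed.

Lemma hp_imp P Q : hp [set x | P x] -> hp [set x | Q x] ->
  hp [set x | P x -> Q x].
Proof.
move=> hP hQ; apply: (hp_ext _ (hp_not (hp_and hP (hp_not hQ)))) => x.
split=> [h Px|h [/h]//].
by apply: contrapT => nQ; apply: h.
Qed.

Lemma hp_iff P Q : hp [set x | P x] -> hp [set x | Q x] ->
  hp [set x | P x <-> Q x].
Proof.
by move=> hP hQ; apply: hp_and; apply: hp_imp.
Qed.

Lemma hp_forall (P : baire -> X -> Prop) :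
  hp [set z : baire * X | P z.1 z.2] -> hp [set x | forall p, P p x].
Proof.
move=> /hp_not hP; apply: (hp_ext _ (hp_not (hp_ex (P := fun p x => ~ P p x) hP))).
move=> x; split=> [h p|h [p]]; last by apply; exact: h.
by apply: contrapT => nP; apply: h; exists p.
Qed.

Lemma hp_forall_countable (I : Type) (P : I -> X -> Prop) :
  countable [set: I] -> (forall i, hp [set x | P i x]) ->
  hp [set x | forall i, P i x].
Proof.
move=> /countable_enumeration[I0|[f fs]] hP.
  apply: (hp_ext _ (hp_cst X True)) => x; split=> // _ i.
  by have : [set: I] i by []; rewrite I0.
apply: (hp_ext _ (hp_forall_nat (fun n => hP (f n)))) => x.
split=> h i; last exact: h.
by have [n <-] := fs i; exact: h.
Qed.

Lemma hp_ex_countable (I : Type) (P : I -> X -> Prop) :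
  countable [set: I] -> (forall i, hp [set x | P i x]) ->
  hp [set x | exists i, P i x].
Proof.
move=> cI hP.
apply: (hp_ext _ (hp_not (hp_forall_countable cI (fun i => hp_not (hP i))))).
move=> x; split=> [h|[i Px] h]; last exact: h Px.
by apply: contrapT => nP; apply: h => i Px; apply: nP; exists i.
Qed.

Lemma hp_rel (A : set (baire * baire)) (f g : X -> baire) :
  hp A -> continuous f -> continuous g -> hp [set x | A (f x, g x)].
Proof.
by move=> hA cf cg; exact: (hp_preimage (pair_continuous cf cg) hA).
Qed.

Lemma hp_set (A : set baire) (f : X -> baire) :
  hp A -> continuous f -> hp [set x | A (f x)].
Proof. by move=> hA cf; exact: (hp_preimage cf hA). Qed.

Lemma hp_enum (f g : X -> baire) : continuous f -> continuous g ->
  hp [set x | enum_open (f x) (g x)].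
Proof.
exact: (hp_rel (A := [set z | enum_open z.1 z.2]) (hp_open open_enum_open)).
Qed.

Lemma hp_coord (f : X -> baire) (n m : nat) : continuous f ->
  hp [set x | f x n = m].
Proof.
apply: (hp_set (A := [set p | p n = m])); apply: hp_open.
rewrite openE => p /= pn.
by apply/nbhs_baireP; exists n.+1 => q /(_ n (leqnn _)) /= <-.
Qed.

End hyperprojective_formulas.

(** The decisive probe sends an enumeration of a neighbourhood base of a point
    of a countably based cover to the image of that point. *)
Lemma open_of_probes (Z : topologicalType) (U : set Z) : qcb0 Z ->
  (forall (S : set baire) (nu : S -> Z), continuous nu -> open (nu @^-1` U)) ->
  open U.
Proof.
move=> [kZ [Y [q [[B /countable_injP[e einj] bB] [_ qP]]]]] hU.
(* The injection [e] numbers the base of [Y]; numbers of no basic set give the empty set. *)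
pose Bn n := [set y | exists A, [/\ B A, e A = n & A y]].
have nBn n y : Bn n y -> nbhs y (Bn n).
  case=> A [BA en Ay]; have : nbhs y A.
    by apply: open_nbhs_nbhs; split=> //; exact: bB.1.
  by apply: filterS => y' Ay'; exists A.
have Bnb y V : nbhs y V -> exists n, Bn n y /\ Bn n `<=` V.
  move=> /(basis_nbhs bB)[A [BA Ay AV]]; exists (e A); split; first by exists A.
  move=> y' [A' [BA' eA A'y]]; apply: AV.
  by rewrite -(einj A' A) ?inE.
pose en (p : baire) y := (forall i, Bn (p i) y) /\
  forall V, nbhs y V -> exists i, Bn (p i) `<=` V.
(* Any finite list of basic neighbourhoods of [y] extends to a name of [y]: position [n + m] lists
   the basic set [m] if it contains [y], and repeats a fixed one containing [y] otherwise. *)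
have en_cons (p : baire) n y : (forall i, (i < n)%N -> Bn (p i) y) ->
    exists2 p', agree n p p' & en p' y.
  move=> pn; have [k [ky _]] := Bnb y _ filterT.
  exists (fun i => if (i < n)%N then p i else
            if `[< Bn (i - n)%N y >] then (i - n)%N else k).
    by move=> i i_n; rewrite i_n.
  split=> [i|V /Bnb[m [my mV]]].
    case: ifP => [/pn//|_]; case: ifP => [/asboolP//|//].
  exists (n + m)%N; rewrite ltnNge leq_addr /= addKn.
  by case: ifP => [//|/negP[]]; exact/asboolP.
pose S := [set p | exists y, en p y].
have SP (p : S) : exists y, en (set_val p) y by exact: set_valP p.
pose nu (p : S) := q (sval (cid (SP p))).
(* A name fixes the neighbourhoods of [y] but perhaps not [y], since [Y] is not assumed T0. The T0
   axiom in [Z] makes the image unique. *)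
have nuE (p : S) y : en (set_val p) y -> nu p = q y.
  rewrite /nu; case: cid => /= y' [p1' p2'] [p1 p2].
  apply: kolmogorov_eq kZ _ => O /qP oO; split=> Oy.
    have /p2'[i iO] : nbhs y' (q @^-1` O) by apply: open_nbhs_nbhs; split.
    exact/iO/p1.
  have /p2[i iO] : nbhs y (q @^-1` O) by apply: open_nbhs_nbhs; split.
  exact/iO/p1'.
have cnu : continuous nu.
  apply/continuousP => O /qP oO; rewrite openE => p /= Op.
  have [y py] := SP p.
  have [i iO] : exists i, Bn (set_val p i) `<=` q @^-1` O.
    apply: py.2; apply: open_nbhs_nbhs; split=> //.
    by rewrite /= -(nuE p y py).
  apply/nbhs_set_type; exists [set p' | agree i.+1 (set_val p) p'].
    by apply/nbhs_baireP; exists i.+1.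
  move=> p' /= /(_ i (leqnn _)) pi; have [y' [p1' p2']] := SP p'.
  by rewrite (nuE p' y') //; apply: iO; rewrite pi.
apply/qP; rewrite openE => y /= Uy.
have [p _ py] := @en_cons (fun=> 0) 0%N y (fun _ => ltac:(done)).
have Sp : S p by exists y.
pose p1 : S := to_set Sp.
have p1E : set_val p1 = p by rewrite to_setE.
have : nbhs p1 (nu @^-1` U).
  by apply: open_nbhs_nbhs; split; [exact: hU|rewrite /= (nuE _ y) ?p1E].
move=> /nbhs_set_type[V]; rewrite p1E => /nbhs_baireP[n nV] VU.
(* Every point of these first [n] basic sets has a name agreeing with [p] up to [n], and such names
   are mapped into [U]. *)
have : nbhs y [set y' | forall i, (i < n)%N -> Bn (p i) y'].
  elim: n {nV} => [|n IH]; first by apply: filterS filterT => y' _ i.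
  apply: filterS (filterI IH (nBn _ _ (py.1 n))) => y' [a b] i.
  by rewrite ltnS leq_eqVlt => /orP[/eqP->//|]; exact: a.
apply: filterS => y' /en_cons[p' pp' py'].
have Sp' : S p' by exists y'.
have := VU (to_set Sp'); rewrite /= to_setE => /(_ (nV _ pp')).
by rewrite (nuE _ y') // to_setE.
Qed.

Lemma continuous_of_probes (Z Y : topologicalType) (f : Z -> Y) : qcb0 Z ->
  (forall (S : set baire) (nu : S -> Z), continuous nu ->
    continuous (fun s => f (nu s))) -> continuous f.
Proof.
move=> qZ h; apply/continuousP => U oU; apply: open_of_probes qZ _ => S nu cnu.
by have /continuousP/(_ _ oU) := h S nu cnu.
Qed.

(** * Codes of open sets of a represented space *)

Section representation_notions.
Variables (X : Type) (R : baire -> X -> Prop).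

Definition rep_dom : set baire := [set p | exists x, R p x].

Definition rep_kernel : set (baire * baire) :=
  [set z | exists x, R z.1 x /\ R z.2 x].

Definition rep_map (p : rep_dom) : X := sval (cid (set_valP p)).

Lemma rep_mapP (p : rep_dom) : R (set_val p) (rep_map p).
Proof. exact: svalP (cid (set_valP p)). Qed.

(** The enumerated set must not separate names of the same point. Through this form the condition
    depends on equality of names only, hence is hyperprojective when that equality is. *)
Definition open_code (r : baire) : Prop :=
  forall p q x, R p x -> R q x -> enum_open r p -> enum_open r q.

Definition coded_open (r : baire) : set X :=
  [set x | exists2 p, R p x & enum_open r p].

End representation_notions.

Section representations.
Variables (X : topologicalType) (R : baire -> X -> Prop).
Hypotheses (tR : total_rep R) (qR : quotient_rep R).

Lemma coded_openE r p x : open_code R r -> R p x ->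
  (coded_open R r x <-> enum_open r p).
Proof.
by move=> cr Rpx; split=> [[q Rqx]|rp]; [exact: cr Rqx Rpx|exists p].
Qed.

Lemma coded_open_surj U : open U ->
  exists2 r, open_code R r & forall x, coded_open R r x <-> U x.
Proof.
move=> /qR[O /enum_open_surj[r rO] OU]; have cr : open_code R r.
  by move=> p q x /OU pU /OU qU; rewrite !rO => /pU/qU.
exists r => // x; have [p Rpx] := tR x.
by rewrite (coded_openE cr Rpx) rO; exact: OU.
Qed.

Lemma rep_inj x y : kolmogorov_space X ->
  (forall r, open_code R r -> coded_open R r x -> coded_open R r y) ->
  (forall r, open_code R r -> coded_open R r y -> coded_open R r x) -> x = y.
Proof.
move=> kX xy yx; apply: kolmogorov_eq kX _ => U /coded_open_surj[r cr rU].
by rewrite -!rU; split; [exact: xy|exact: yx].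
Qed.

Lemma rep_functional p x y : kolmogorov_space X -> R p x -> R p y -> x = y.
Proof.
by move=> kX Rx Ry; apply: rep_inj => // r cr;
  rewrite (coded_openE cr Rx) (coded_openE cr Ry).
Qed.

Lemma rep_map_continuous : kolmogorov_space X -> continuous (@rep_map X R).
Proof.
move=> kX; apply/continuousP => U /qR[O oO OU]; exists O => //.
by apply/seteqP; split=> p /=; have := OU _ _ (rep_mapP p) => -[].
Qed.

(** Openness in [z] for a fixed code is continuity of [nu]; the gain is openness jointly in [z] and
    [r], so that the codes of neighbourhoods of [nu z] can be enumerated continuously in [z]. Pairs
    of a point and a code form a first countable space, to which [probe_open] applies. *)
Lemma open_param (Z : set baire) (nu : Z -> X) : continuous nu ->
  exists2 W : set (baire * baire), open W &
    forall z r, open_code R r -> (W (set_val z, r) <-> coded_open R r (nu z)).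
Proof.
move=> cnu; pose T := [set zr : baire * baire | Z zr.1 /\ open_code R zr.2].
pose pz (t : T) : Z := restr (fun t : T => (set_valP t).1) t.
pose pr (t : T) := (set_val t).2.
have oT : open [set t : T | coded_open R (pr t) (nu (pz t))].
  apply: (@probe_open X T R (open_code R) (fun x r => coded_open R r x)
    [set z | enum_open z.2 z.1] (fun t => nu (pz t)) pr) => //.
  - apply: first_countable_set.
    by apply: first_countable_prod; exact: first_countable_baire.
  - have /continuousP/(_ _ open_enum_open) := @pair_continuous _ baire baire _ _
      (@snd_comp_continuous _ baire baire _ (@id_continuous _))
      (@fst_comp_continuous _ baire baire _ (@id_continuous _)).
    by [].
  - by move=> p x b Rpx cb; rewrite (coded_openE cb Rpx).
  - apply: compose_continuous cnu; apply: restr_continuous.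
    exact: fst_comp_continuous (@set_val_continuous _ _).
  - exact: snd_comp_continuous (@set_val_continuous _ _).
  - by move=> t; have [] := set_valP t.
have [W oW WE] := open_set_type oT; exists W => // z r cr.
have Tzr : T (set_val z, r) by split=> //; exact: set_valP.
pose t : T := to_set Tzr.
have tE : set_val t = (set_val z, r) by rewrite to_setE.
have ptz : pz t = z by apply: set_val_inj; rewrite restrE tE.
have -> : coded_open R r (nu z) = [set t : T | coded_open R (pr t) (nu (pz t))] t.
  by rewrite /= ptz /pr tE.
by rewrite -WE /= tE.
Qed.

Lemma hp_rep_dom (Y : topologicalType) (f : Y -> baire) : hp (rep_kernel R) ->
  continuous f -> hp [set y | rep_dom R (f y)].
Proof.
move=> hk cf; apply: (hp_ext _ (hp_rel hk cf cf)) => y.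
by split=> [[x []]|[x]]; exists x.
Qed.

Lemma hp_open_code (Y : topologicalType) (f : Y -> baire) : hp (rep_kernel R) ->
  continuous f -> hp [set y | open_code R (f y)].
Proof.
move=> hk cf.
apply: (hp_ext (P := fun y => forall p q, rep_kernel R (p, q) ->
    enum_open (f y) p -> enum_open (f y) q)).
  move=> y; split=> [h p q x Rp Rq|h p q [x [/= Rp Rq]]].
    by apply: h; exists x.
  exact: h Rp Rq.
apply: hp_forall; apply: hp_forall; apply: hp_imp.
  apply: hp_rel hk _ _.
    by apply: fst_comp_continuous; apply: snd_comp_continuous; exact: id_continuous.
  by apply: fst_comp_continuous; exact: id_continuous.
have cfzz : continuous (fun z : baire * (baire * Y) => f z.2.2).
  apply: compose_continuous cf; do 2 apply: snd_comp_continuous.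
  exact: id_continuous.
by apply: hp_imp; apply: hp_enum => //; apply: fst_comp_continuous;
  try apply: snd_comp_continuous; exact: id_continuous.
Qed.

End representations.

(** * Spaces with hyperprojective equality *)

(** The lifting half of admissibility; continuity is contained in [quotient_rep]. *)
Definition admissible_rep (X : topologicalType) (R : baire -> X -> Prop) :=
  forall (Z : set baire) (nu : Z -> X), continuous nu ->
    exists2 g : Z -> baire, continuous g & forall z, R (g z) (nu z).

(** An admissible representation of a qcb0-space is a quotient map: every probe factors through it,
    so a set whose names form a relatively open set has open preimage under all probes. *)
Lemma QCB0_HP_rep (X : topologicalType) : QCB0_HP X ->
  exists R : baire -> X -> Prop,
    [/\ total_rep R, quotient_rep R, hp (rep_kernel R) & admissible_rep R].
Proof.
move=> [alpha [qX [D [delta [rd [cd ad] Sd]]]]].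
exists (fun p x => exists a : D, set_val a = p /\ delta a = x); split.
- move=> x; have [a _ <-] : range delta x by rewrite rd.
  by exists (set_val a), a.
- move=> U; split=> [oU|[O oO OU]].
    have /continuousP/(_ _ oU)/open_set_type[O oO OU] := cd.
    exists O => // _ _ [a [<- <-]].
    by rewrite -[U _]/((delta @^-1` U) a) -OU.
  apply: open_of_probes qX _ => S nu /ad[g [cg ->]].
  have /continuousP/(_ _ oO) := compose_continuous cg (@set_val_continuous _ _).
  congr open; apply/seteqP; split=> s /=.
    by apply: (OU _ _ _).1; exists (g s).
  by apply: (OU _ _ _).2; exists (g s).
- exists alpha; move: Sd; congr (Sigma1 _).
  apply/seteqP; split=> z.
    by move=> [a [b [az bz ab]]]; exists (delta a); split; [exists a|exists b].
  by move=> [x [[a [az ax]] [b [bz bx]]]]; exists a, b; rewrite bx.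
- move=> Z nu /ad[g [cg ->]]; exists (fun z => set_val (g z)).
    exact: compose_continuous cg (@set_val_continuous _ _).
  by move=> z; exists (g z).
Qed.

(** A point is represented anew by the enumerations of the set of codes of its
    open neighbourhoods; unlike the original representation this one is
    admissible, and its equality is still hyperprojective. *)
Lemma QCB0_HP_of_quotient_rep (X : topologicalType) (R : baire -> X -> Prop) :
  kolmogorov_space X -> total_rep R -> quotient_rep R -> hp (rep_kernel R) ->
  QCB0_HP X.
Proof.
move=> kX tR qR hR.
(* Nothing is asked of [q] at sequences that are not codes, because the open relation given by
   [open_param] is controlled at codes only. *)
pose R' q x := forall r, open_code R r -> (enum_open q r <-> coded_open R r x).
have lift (Z : set baire) (nu : Z -> X) : continuous nu ->
    exists2 g : baire -> baire, continuous g & forall z, R' (g (set_val z)) (nu z).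
  move=> /(open_param tR qR)[W /enum_open_param[g cg gW] WE].
  by exists g => // z r cr; rewrite gW; exact: WE.
have R'inj q x y : R' q x -> R' q y -> x = y.
  move=> Rx Ry; apply: (rep_inj tR qR kX) => r cr.
    by move=> /(Rx r cr)/(Ry r cr).
  by move=> /(Ry r cr)/(Rx r cr).
pose D := rep_dom R'; pose delta := @rep_map X R'.
have dE (p : D) x : R' (set_val p) x -> delta p = x.
  by move=> Rx; apply: R'inj (rep_mapP p) Rx.
have dom p x : R' p x -> D p by exists x.
have sD : range delta = setT.
  apply/seteqP; split=> // x _.
  have [g _ gx] := lift setT (fun=> x) (@cst_continuous _ _ x).
  have Rx := gx (to_set (I : [set: baire] (fun=> 0))).
  exists (to_set (dom _ _ Rx)) => //; apply: dE.
  by rewrite to_setE.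
have cd : continuous delta.
  apply/continuousP => U /(coded_open_surj tR qR)[r cr rU].
  exists [set q | enum_open q r].
    have /continuousP/(_ _ open_enum_open) := pair_continuous
      (@id_continuous baire) (@cst_continuous baire baire r).
    by [].
  apply/seteqP; split=> p /=; have /(_ r cr) := rep_mapP p; rewrite rU;
    by case.
have ad : admissible delta.
  split=> // Z nu /lift[g cg gnu].
  have h (z : Z) : D (g (set_val z)) by exact: dom _ _ (gnu z).
  exists (restr h); split.
    apply: restr_continuous.
    exact: compose_continuous (@set_val_continuous _ _) cg.
  by apply/funext => z /=; rewrite (@dE _ (nu z)) // restrE.
have hE : hp (EQ delta).
  (* An old name [d] stands for the common point, which turns the quantifier over [X] into one over
     the Baire space. *)
  apply: (hp_ext (P := fun z => exists d, rep_dom R d /\ forall r, open_code R r ->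
    (enum_open z.1 r <-> enum_open r d) /\ (enum_open z.2 r <-> enum_open r d))).
    move=> z; split.
      move=> [d [[x Rdx] h]].
      have R1 : R' z.1 x.
        by move=> r cr; rewrite (coded_openE cr Rdx); exact: (h r cr).1.
      have R2 : R' z.2 x.
        by move=> r cr; rewrite (coded_openE cr Rdx); exact: (h r cr).2.
      exists (to_set (dom _ _ R1)), (to_set (dom _ _ R2)).
      rewrite !to_setE; split=> //.
      by rewrite (@dE _ x) ?(@dE _ x) // to_setE.
    move=> [a [b [az bz ab]]]; have [d Rd] := tR (delta a).
    exists d; split; first by exists (delta a).
    have := rep_mapP b; rewrite -[rep_map b]/(delta b) -ab bz => Rb.
    have := rep_mapP a; rewrite -[rep_map a]/(delta a) az => Ra.
    move=> r cr; have := Ra r cr; have := Rb r cr.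
    by rewrite (coded_openE cr Rd).
  have c1 : continuous (fun z : baire * (baire * (baire * baire)) => z.1).
    by apply: fst_comp_continuous; exact: id_continuous.
  have c2 : continuous (fun z : baire * (baire * (baire * baire)) => z.2.1).
    by apply: fst_comp_continuous; apply: snd_comp_continuous; exact: id_continuous.
  have c3 : continuous (fun z : baire * (baire * (baire * baire)) => z.2.2.1).
    apply: fst_comp_continuous; do 2 apply: snd_comp_continuous.
    exact: id_continuous.
  have c4 : continuous (fun z : baire * (baire * (baire * baire)) => z.2.2.2).
    by do 3 apply: snd_comp_continuous; exact: id_continuous.
  apply: hp_ex; apply: hp_and.
    apply: hp_rep_dom => //; apply: fst_comp_continuous; exact: id_continuous.
  apply: hp_forall; apply: hp_imp; first exact: hp_open_code.
  by apply: hp_and; apply: hp_iff; exact: hp_enum.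
have [alpha Sa] := hE; exists alpha; split; last by exists D, delta.
split=> //; exists (rep_dom R), (@rep_map X R); split.
  by apply: second_countable_set; exact: second_countable_baire.
split=> [|U]; last split=> [|[O oO OU]].
- apply/seteqP; split=> // x _; have [p Rp] := tR x.
  have Dp : rep_dom R p by exists x.
  exists (to_set Dp) => //.
  apply: (rep_functional tR qR kX) (rep_mapP _) _.
  by rewrite to_setE.
- by move/continuousP: (rep_map_continuous qR kX); apply.
- apply/qR; exists O => // p x Rp; have Dp : rep_dom R p by exists x.
  have vE : set_val (to_set Dp : rep_dom R) = p by rewrite to_setE.
  have <- : rep_map (to_set Dp) = x.
    by apply: (rep_functional tR qR kX (rep_mapP _)); rewrite vE.
  by rewrite -[U _]/((rep_map (R:=R) @^-1` U) _) -OU /= vE.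
Qed.

(** [T] with the final topology of a representation. *)
Definition rep_space (T : Type) (R : baire -> T -> Prop) : Type := T.

Section rep_space_topology.
Variables (T : Type) (R : baire -> T -> Prop).

HB.instance Definition _ := gen_eqMixin (rep_space R).
HB.instance Definition _ := gen_choiceMixin (rep_space R).

Let rep_open (U : set (rep_space R)) := exists2 O : set baire, open O &
  forall p (x : T), R p x -> (O p <-> U x).

Let rep_openT : rep_open setT.
Proof. by exists setT => //; exact: openT. Qed.

Let rep_openI : setI_closed rep_open.
Proof.
move=> A B [O oO OA] [O' oO' OB]; exists (O `&` O'); first exact: openI.
by move=> p x Rp; split=> -[/(OA p x Rp) a /(OB p x Rp) b].
Qed.

Let rep_open_bigU (I : Type) (f : I -> set (rep_space R)) :
  (forall i, rep_open (f i)) -> rep_open (\bigcup_i f i).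
Proof.
move=> h; have /choice[O OP] : forall i, exists O : set baire, open O /\
    forall p (x : T), R p x -> (O p <-> f i x).
  by move=> i; have [O oO Of] := h i; exists O.
exists (\bigcup_i O i); first by apply: bigcup_open => i _; exact: (OP i).1.
by move=> p x Rp; split=> -[i _ /((OP i).2 p x Rp) ?]; exists i.
Qed.

HB.instance Definition _ := isOpenTopological.Build (rep_space R)
  rep_openT rep_openI rep_open_bigU.

Lemma quotient_rep_space : @quotient_rep (rep_space R) R.
Proof. by []. Qed.

End rep_space_topology.

Lemma kolmogorov_joint (X : topologicalType) (I : Type)
    (Y : I -> topologicalType) (f : forall i, X -> Y i) :
  (forall i, continuous (f i)) -> (forall i, kolmogorov_space (Y i)) ->
  (forall x y, (forall i, f i x = f i y) -> x = y) -> kolmogorov_space X.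
Proof.
move=> cf kY inj; apply: kolmogorovP => x y h; apply: inj => i.
apply: kolmogorov_eq (kY i) _ => U oU; apply: (h (f i @^-1` U)).
by move/continuousP: (cf i); exact.
Qed.

Lemma continuous_to_rep (S X : topologicalType) (R : baire -> X -> Prop)
    (f : S -> X) (g : S -> baire) :
  quotient_rep R -> continuous g -> (forall s, R (g s) (f s)) -> continuous f.
Proof.
move=> qR /continuousP cg Rg; apply/continuousP => U /qR[O oO OU].
have -> : f @^-1` U = g @^-1` O; last exact: cg.
by apply/seteqP; split=> s /(OU _ _ (Rg s)).
Qed.

(** A name of [x] determines an open set of codes of neighbourhoods of [f x]; in a T0 space, [z.2]
    names [f x] exactly when it lies in the open sets with these codes and in no other coded
    ones. *)
Lemma hp_graph (X Y : topologicalType) (RX : baire -> X -> Prop)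
    (RY : baire -> Y -> Prop) (f : X -> Y) :
  kolmogorov_space X -> kolmogorov_space Y -> total_rep RX -> total_rep RY ->
  quotient_rep RX -> quotient_rep RY -> hp (rep_kernel RX) ->
  hp (rep_kernel RY) -> continuous f ->
  hp [set z : baire * baire | exists x, RX z.1 x /\ RY z.2 (f x)].
Proof.
move=> kX kY tX tY qX qY hX hY cf.
have [W oW WE] := open_param tY qY
  (compose_continuous (rep_map_continuous qX kX) cf).
apply: (hp_ext (P := fun z => rep_dom RX z.1 /\ rep_dom RY z.2 /\
    forall r, open_code RY r -> (W (z.1, r) <-> enum_open r z.2))).
  move=> [p q] /=.
  have WE' x r : RX p x -> open_code RY r ->
      (W (p, r) <-> coded_open RY r (f x)).
    move=> Rx cr; have Dp : rep_dom RX p by exists x.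
    have := WE (to_set Dp) r cr; rewrite to_setE.
    suff -> : rep_map (to_set Dp) = x by [].
    apply: (rep_functional tX qX kX (rep_mapP _)).
    by rewrite to_setE.
  split=> [[[x Rx] [[y Ry] h]]|[x [Rx Ry]]].
    exists x; split=> //; suff -> : f x = y by [].
    apply: (rep_inj tY qY kY) => r cr.
      by move=> /(WE' x r Rx cr)/(h r cr) rq; exists q.
    rewrite (coded_openE cr Ry) => /(h r cr).
    by rewrite (WE' x r Rx cr).
  split; first by exists x.
  split; first by exists (f x).
  by move=> r cr; rewrite (WE' x r Rx cr) (coded_openE cr Ry).
have cf1 : continuous (fun z : baire * baire => z.1).
  by apply: fst_comp_continuous; exact: id_continuous.
have cs2 : continuous (fun z : baire * baire => z.2).
  by apply: snd_comp_continuous; exact: id_continuous.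
apply: hp_and; first exact: hp_rep_dom.
apply: hp_and; first exact: hp_rep_dom.
have c1 : continuous (fun z : baire * (baire * baire) => z.1).
  by apply: fst_comp_continuous; exact: id_continuous.
have c2 : continuous (fun z : baire * (baire * baire) => z.2.1).
  by apply: fst_comp_continuous; apply: snd_comp_continuous; exact: id_continuous.
have c3 : continuous (fun z : baire * (baire * baire) => z.2.2).
  by do 2 apply: snd_comp_continuous; exact: id_continuous.
apply: hp_forall; apply: hp_imp; first exact: hp_open_code.
apply: hp_iff; last exact: hp_enum.
exact: (hp_rel (hp_open oW)).
Qed.

Lemma QCB0_HP_qcb0 X : QCB0_HP X -> qcb0 X.
Proof. by move=> [alpha []]. Qed.

Lemma QCB0_HP_kolmogorov X : QCB0_HP X -> kolmogorov_space X.
Proof. by move=> /QCB0_HP_qcb0[]. Qed.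

Lemma QCB0_HP_sierpinski : QCB0_HP sierpinski.
Proof.
pose R (p : baire) (x : sierpinski) := (x : bool) = `[< exists n, p n <> 0 >].
have oR : open [set p : baire | exists n, p n <> 0].
  rewrite openE => p [n pn]; apply/nbhs_baireP; exists n.+1 => q pq.
  by exists n; rewrite -(pq n).
apply: (@QCB0_HP_of_quotient_rep _ R).
- apply: kolmogorovP => -[] -[] // h.
    by have := h [set true] (Or32 _ _ erefl) => -[/(_ erefl)].
  by have := h [set true] (Or32 _ _ erefl) => -[_ /(_ erefl)].
- case; first by exists (fun=> 1); apply/esym/asboolP; exists 0.
  by exists (fun=> 0); apply/esym/asboolP => -[].
- move=> U; split=> [[->|->|->]|[O oO OU]].
  + by exists set0 => //; exact: open0.
  + exists [set p : baire | exists n, p n <> 0] => // p x ->.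
    by split=> [/asboolP|/asboolP].
  + by exists setT => //; exact: openT.
  have UTF : U false -> U true.
    move=> /(OU (fun=> 0)) h; have O0 : O (fun=> 0).
      by apply: h; apply/esym/asboolP => -[].
    have := oO; rewrite openE => /(_ _ O0)/nbhs_baireP[n nO].
    (* A name of [true] inside the given neighbourhood of the zero sequence, which names [false]. *)
    apply: (OU (fun i => if (i < n)%N then 0 else 1) _ _).1.
      by apply/esym/asboolP; exists n; rewrite ltnn.
    by apply: nO => i ->.
  have [Uf|nUf] := pselect (U false).
    by apply: Or33; apply/seteqP; split=> // -[] _ //; exact: UTF.
  have [Ut|nUt] := pselect (U true).
    by apply: Or32; apply/seteqP; split=> [[]//|_ ->].
  by apply: Or31; apply/seteqP; split=> [[]|].
- have hR (f : baire * baire -> baire) : continuous f ->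
      hp [set z | exists n, f z n <> 0].
    by move=> cf; apply: hp_ex_countable => [|n]; [exact: countableP|
      apply: hp_not; exact: hp_coord].
  apply: (hp_ext _ (hp_iff (hR _ (@fst_comp_continuous _ _ _ _ (@id_continuous _)))
    (hR _ (@snd_comp_continuous _ _ _ _ (@id_continuous _))))) => z.
  split=> [h|[x [e1 e2]]]; last exact: asbool_eq_equiv (etrans (esym e1) e2).
  exists `[< exists n, z.1 n <> 0 >]; split=> //; rewrite /R.
  exact/asbool_equiv_eq.
Qed.

(** * Countable limits and colimits *)

Lemma diagram_rep (J : category) (D : diagram J) :
  countable_category J -> (forall a, QCB0_HP (D a)) ->
  exists (R : forall a, baire -> D a -> Prop) (index : J -> nat),
    injective index /\ forall a,
      [/\ total_rep (R a), quotient_rep (R a), hp (rep_kernel (R a))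
        & admissible_rep (R a)].
Proof.
move=> cJ hD; have /countable_injP[e einj] := cJ.1.
exists (fun a => sval (cid (QCB0_HP_rep (hD a)))), e; split.
  by move=> a b; apply: einj; rewrite inE.
by move=> a; exact: svalP (cid (QCB0_HP_rep (hD a))).
Qed.

Section diagrams.
Variables (J : category) (D : diagram J).
Hypothesis cJ : countable_category J.
Variable R : forall a, baire -> D a -> Prop.
Arguments R : clear implicits.
Hypothesis kD : forall a, kolmogorov_space (D a).
Hypothesis RP : forall a,
  [/\ total_rep (R a), quotient_rep (R a), hp (rep_kernel (R a))
    & admissible_rep (R a)].
Variable index : J -> nat.
Hypothesis index_inj : injective index.

Let R_fun a p x y : R a p x -> R a p y -> x = y.
Proof.
by have [tR qR _ _] := RP a => h1; exact: (rep_functional tR qR (@kD a) h1).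
Qed.

Let hp_dmap a b (f : hom a b) :
  hp [set z : baire * baire | exists x, R a z.1 x /\ R b z.2 (dmap f x)].
Proof.
have [ta qa ha _] := RP a; have [tb qb hb _] := RP b.
exact: hp_graph (@kD a) (@kD b) ta tb qa qb ha hb (@dmap_continuous _ D a b f).
Qed.

Definition limit_points :=
  {x : forall a, D a | forall a b (f : hom a b), dmap f (x a) = x b}.

Definition limit_rep (p : baire) (x : limit_points) :=
  forall a, R a (rowb (index a) p) (sval x a).

Let L : topologicalType := rep_space limit_rep.

Definition limit_proj a (x : L) : D a := sval (x : limit_points) a.

Lemma limit_eq (x y : L) : (forall a, limit_proj a x = limit_proj a y) -> x = y.
Proof.
case: x y => [x xP] [y yP] /= xy; apply: eq_exist => /=.
by apply: functional_extensionality_dep.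
Qed.

(** Lifts are chosen row by row. Injectivity of [index] lets each row serve at most one object, and
    the remaining rows are zero. *)
Lemma limit_lift (Z : set baire) (q : forall a, Z -> D a) :
  (forall a, continuous (q a)) ->
  exists2 g : Z -> baire, continuous g &
    forall a z, R a (rowb (index a) (g z)) (q a z).
Proof.
move=> cq.
have /choice[G GP] : forall n, exists G : Z -> baire, continuous G /\
    forall a, index a = n -> forall z, R a (G z) (q a z).
  move=> n; have [[a an]|na] := pselect (exists a, index a = n).
    have [_ _ _ /(_ _ _ (cq a))[g cg gP]] := RP a.
    by exists g; split=> // b; rewrite -an => /index_inj ->.
  exists (fun=> fun=> 0); split; first exact: cst_continuous.
  by move=> a an; case: na; exists a.
exists (fun z => table (fun n => G n z)).
  by apply: table_continuous => n; exact: (GP n).1.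
by move=> a z; rewrite rowb_table; exact: (GP _).2.
Qed.

Lemma limit_rep_total : total_rep limit_rep.
Proof.
move=> x; have [g _ gP] := limit_lift (Z := setT)
  (fun a => @cst_continuous _ _ (limit_proj a x)).
by exists (g (to_set (I : [set: baire] (fun=> 0)))) => a; exact: gP.
Qed.

Lemma limit_proj_continuous a : continuous (limit_proj a).
Proof.
apply/continuousP => U; have [_ qR _ _] := RP a => /qR[O oO OU].
exists (rowb (index a) @^-1` O).
  by move/continuousP: (@rowb_continuous (index a)); exact.
by move=> p x Rp; exact: OU (Rp a).
Qed.

Lemma limit_kolmogorov : kolmogorov_space L.
Proof. exact: kolmogorov_joint limit_proj_continuous (@kD) limit_eq. Qed.

Lemma hp_limit_rep : hp (rep_kernel limit_rep).
Proof.
pose T a b (f : hom a b) :=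
  [set z : baire * baire | exists x, R a z.1 x /\ R b z.2 (dmap f x)].
(* Equality of the rows alone would admit families that are not compatible with the arrows; the
   second conjunct excludes them by countably many graph conditions. *)
apply: (hp_ext (P := fun z =>
   (forall a, rep_kernel (R a) (rowb (index a) z.1, rowb (index a) z.2)) /\
   forall a b (f : hom a b), T a b f (rowb (index a) z.1, rowb (index b) z.2))).
  move=> z; split=> [[h hf]|[x [Rx Ry]]]; last first.
    split=> [a|a b f]; first by exists (sval x a); split; [exact: Rx|exact: Ry].
    exists (sval x a); split; first exact: Rx.
    by rewrite (svalP x a b f); exact: Ry.
  pose x a := sval (cid (h a)).
  have xP a : R a (rowb (index a) z.1) (x a) /\ R a (rowb (index a) z.2) (x a).
    exact: svalP (cid (h a)).
  have xf a b (f : hom a b) : dmap f (x a) = x b.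
    have [y [/= Ry Ry']] := hf a b f.
    rewrite -(R_fun Ry (xP a).1); exact: R_fun Ry' (xP b).2.
  by exists (exist _ x xf); split=> a; have [] := xP a.
have c1 a : continuous (fun z : baire * baire => rowb (index a) z.1).
  apply: compose_continuous (@rowb_continuous _).
  by apply: fst_comp_continuous; exact: id_continuous.
have c2 a : continuous (fun z : baire * baire => rowb (index a) z.2).
  apply: compose_continuous (@rowb_continuous _).
  by apply: snd_comp_continuous; exact: id_continuous.
apply: hp_and.
  apply: hp_forall_countable cJ.1 _ => a; have [_ _ ha _] := RP a.
  exact: (hp_rel ha).
apply: hp_forall_countable cJ.1 _ => a; apply: hp_forall_countable cJ.1 _ => b.
apply: hp_forall_countable (cJ.2 a b) _ => f; exact: (hp_rel (hp_dmap f)).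
Qed.

Lemma QCB0_HP_limit : QCB0_HP L.
Proof.
apply: QCB0_HP_of_quotient_rep limit_kolmogorov limit_rep_total _ hp_limit_rep.
exact: quotient_rep_space.
Qed.

Lemma limit_is_limit : is_limit qcb0 limit_proj.
Proof.
split.
- exact: QCB0_HP_qcb0 QCB0_HP_limit.
- split; first exact: limit_proj_continuous.
  by move=> a b f; apply/funext => x; exact: (svalP x a b f).
move=> Z q qZ [cq qf].
have uP z a b (f : hom a b) : dmap f (q a z) = q b z by rewrite -(qf a b f).
pose u (z : Z) : L := (exist _ (fun a => q a z) (uP z) : limit_points).
exists u; split; last first.
  by move=> u' [_ pu']; apply/funext => z; apply: limit_eq => a;
    rewrite -[RHS]/((limit_proj a \o u') z) pu'.
(* The given maps lift to names along probes into [Z], not on [Z] itself. *)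
split=> //; apply: continuous_of_probes qZ _ => S nu cnu.
have [g cg gP] := limit_lift (fun a => compose_continuous cnu (cq a)).
by apply: (continuous_to_rep (@quotient_rep_space _ limit_rep) cg) => s a.
Qed.


(** These are the open sets of the topological colimit, presented as compatible families of open
    sets of the objects. *)
Definition colimit_nbhd (U : forall a, set (D a)) : Prop :=
  (forall a, open (U a)) /\
  forall a b (f : hom a b) x, U b (dmap f x) <-> U a x.

Definition colimit_filter a (x : D a) : set (forall a, set (D a)) :=
  [set U | colimit_nbhd U /\ U a x].

Lemma colimit_filter_dmap a b (f : hom a b) (x : D a) :
  colimit_filter (dmap f x) = colimit_filter x.
Proof.
by apply/seteqP; split=> U [nU Ux]; split=> //; exact/(nU.2 a b f).
Qed.

(** A point of the T0 quotient of the topological colimit is given by its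
    neighbourhood filter. *)
Definition colimit_points :=
  {F : set (forall a, set (D a)) | exists a (x : D a), F = colimit_filter x}.

Definition coproduct_rep (p : baire) a (x : D a) : Prop :=
  p 0 = index a /\ R a (tailb p) x.

Definition colimit_rep (p : baire) (F : colimit_points) : Prop :=
  exists a (x : D a), coproduct_rep p x /\ sval F = colimit_filter x.

Let C : topologicalType := rep_space colimit_rep.

Definition colimit_inj a (x : D a) : C :=
  exist _ (colimit_filter x) (ex_intro _ a (ex_intro _ x erefl))
  : colimit_points.

Lemma colimit_rep_inj p a (x : D a) : coproduct_rep p x ->
  colimit_rep p (colimit_inj x).
Proof. by move=> px; exists a, x. Qed.

Lemma colimit_inj_surj (F : C) : exists a (x : D a), F = colimit_inj x.
Proof.
case: F => F /[dup] FP [a [x Fx]]; exists a, x.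
by apply: eq_exist.
Qed.

Lemma coproduct_rep_cons a (x : D a) p : R a p x ->
  coproduct_rep (consb (index a) p) x.
Proof. by move=> Rx; split=> //; rewrite consbK. Qed.

Lemma colimit_inj_continuous a : continuous (@colimit_inj a).
Proof.
apply/continuousP => U [O oO OU]; have [_ qR _ _] := RP a; apply/qR.
exists (consb (index a) @^-1` O).
  by move/continuousP: (@consb_continuous (index a)); exact.
move=> p x /coproduct_rep_cons /colimit_rep_inj Rp.
exact: OU Rp.
Qed.

Lemma coproduct_open (U : forall a, set (D a)) : (forall a, open (U a)) ->
  exists2 O : set baire, open O &
    forall p a (x : D a), coproduct_rep p x -> (O p <-> U a x).
Proof.
move=> oU; have H a : exists O : set baire, open O /\
    forall p x, R a p x -> (O p <-> U a x).
  by have [_ qR _ _] := RP a; have /qR[O oO OU] := oU a; exists O.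
pose O a := sval (cid (H a)); have OP a := svalP (cid (H a)).
exists (\bigcup_a ([set p | p 0 = index a] `&` tailb @^-1` (O a))).
  apply: bigcup_open => a _; apply: openI.
    rewrite openE => p /= pa; apply/nbhs_baireP; exists 1%N => q pq /=.
    by rewrite -(pq 0).
  by move/continuousP: tailb_continuous; apply; exact: (OP a).1.
move=> p a x [pa Rx]; split=> [[b _ [/= pb Ob]]|Ux].
  have ab : b = a by apply: index_inj; rewrite -pa -pb.
  by rewrite ab in Ob; apply/((OP a).2 _ _ Rx).
by exists a => //; split=> //; apply/((OP a).2 _ _ Rx).
Qed.

Lemma colimit_open (U : forall a, set (D a)) : colimit_nbhd U ->
  open [set F : C | sval (F : colimit_points) U].
Proof.
move=> nU; have [O oO OU] := coproduct_open nU.1; exists O => //.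
move=> p F [a [x [px Fx]]]; rewrite /= Fx (OU _ _ _ px).
by split=> [|[]].
Qed.

Lemma colimit_kolmogorov : kolmogorov_space C.
Proof.
apply: kolmogorovP => F G FG.
suff e : sval (F : colimit_points) = sval (G : colimit_points).
  by case: F G e {FG} => F FP [G GP] /= e; exact: eq_exist.
have [a [x Fx]] := svalP (F : colimit_points).
have [b [y Gy]] := svalP (G : colimit_points).
apply/seteqP; split=> U.
  move=> FU; have [nU _] : colimit_filter x U by rewrite -Fx.
  exact: (FG _ (colimit_open nU)).1 FU.
move=> GU; have [nU _] : colimit_filter y U by rewrite -Gy.
exact: (FG _ (colimit_open nU)).2 GU.
Qed.

Lemma colimit_rep_total : total_rep colimit_rep.
Proof.
move=> F; have [a [x Fx]] := svalP F; have [tR _ _ _] := RP a.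
have [p /coproduct_rep_cons px] := tR x.
by exists (consb (index a) p), a, x.
Qed.

(** Single arrows, not zigzags: a set that respects every arrow respects the equivalence relation
    which the arrows generate. *)
Definition coproduct_edge (p q : baire) : Prop :=
  exists a b (f : hom a b) x, coproduct_rep p x /\ coproduct_rep q (dmap f x).

Definition colimit_code (r : baire) : Prop := forall p q,
  coproduct_edge p q -> (enum_open r p <-> enum_open r q).

Lemma colimit_code_nbhd r : colimit_code r ->
  exists2 U, colimit_nbhd U & forall p a (x : D a), coproduct_rep p x ->
    (enum_open r p <-> U a x).
Proof.
move=> cr; pose U a := [set x : D a | exists2 p, coproduct_rep p x & enum_open r p].
have rU p a (x : D a) : coproduct_rep p x -> (enum_open r p <-> U a x).
  move=> px; split=> [rp|[q qx rq]]; first by exists p.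
  (* The identity arrow joins any two names of [x], so membership does not depend on the name. *)
  apply/(cr p q) => //; exists a, a, (idm a), x; split=> //.
  by rewrite dmap_id.
exists U => //; split=> [a|a b f x].
  have [_ qR _ _] := RP a; apply/qR.
  exists (consb (index a) @^-1` enum_open r).
    move/continuousP: (@consb_continuous (index a)); apply.
    exact: open_enum_openP.
  by move=> p x /coproduct_rep_cons px; exact: rU px.
have [ta _ _ _] := RP a; have [tb _ _ _] := RP b.
have [p /coproduct_rep_cons px] := ta x.
have [q /coproduct_rep_cons qx] := tb (dmap f x).
rewrite -(rU _ _ _ px) -(rU _ _ _ qx); symmetry; apply: cr.
by exists a, b, f, x.
Qed.

Lemma colimit_nbhd_code U : colimit_nbhd U ->
  exists2 r, colimit_code r & forall p a (x : D a), coproduct_rep p x ->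
    (enum_open r p <-> U a x).
Proof.
move=> [oU iU]; have [O /enum_open_surj[r rO] OU] := coproduct_open oU.
exists r => [p q [a [b [f [x [px qx]]]]]|p a x px]; rewrite !rO.
  by rewrite (OU _ _ _ px) (OU _ _ _ qx) iU.
exact: OU px.
Qed.

(** Points of the colimit are equal when they lie in the same compatible families of open sets. Such
    families correspond to sequences satisfying [colimit_code], so this is a quantifier over the
    Baire space. *)
Lemma hp_colimit_rep : hp (rep_kernel colimit_rep).
Proof.
pose dom p := exists a (x : D a), coproduct_rep p x.
apply: (hp_ext (P := fun z => (dom z.1 /\ dom z.2) /\ forall r, colimit_code r ->
    (enum_open r z.1 <-> enum_open r z.2))).
  move=> [p q] /=; split.
    move=> [[[a [x px]] [b [y qy]]] h]; exists (colimit_inj x).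
    split; first exact: colimit_rep_inj.
    exists b, y; split=> //=; apply/seteqP; split=> U [nU Ux]; split=> //.
      have [r cr rU] := colimit_nbhd_code nU.
      by apply/(rU _ _ _ qy)/(h r cr)/(rU _ _ _ px).
    have [r cr rU] := colimit_nbhd_code nU.
    by apply/(rU _ _ _ px)/(h r cr)/(rU _ _ _ qy).
  move=> [F [[a [x [px Fx]]] [b [y [qy Fy]]]]].
  split; first by split; [exists a, x|exists b, y].
  move=> r /colimit_code_nbhd[U nU rU]; rewrite (rU _ _ _ px) (rU _ _ _ qy).
  have xy : colimit_filter x = colimit_filter y by rewrite -Fx -Fy.
  split=> h.
    by have [] : colimit_filter y U by rewrite -xy.
  by have [] : colimit_filter x U by rewrite xy.
have hdom (Y : topologicalType) (f : Y -> baire) : continuous f ->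
    hp [set y | dom (f y)].
  move=> cf; apply: (hp_ext (P := fun y => exists a,
      f y 0 = index a /\ rep_dom (R a) (tailb (f y)))).
    move=> y; split=> -[a]; first by move=> [pa [x Rx]]; exists a, x.
    by move=> [x [pa Rx]]; exists a; split=> //; exists x.
  apply: hp_ex_countable cJ.1 _ => a; apply: hp_and; first exact: hp_coord.
  have [_ _ ha _] := RP a; apply: hp_rep_dom ha _.
  exact: compose_continuous cf tailb_continuous.
have hedge (Y : topologicalType) (f g : Y -> baire) : continuous f ->
    continuous g -> hp [set y | coproduct_edge (f y) (g y)].
  move=> cf cg; apply: hp_ex_countable cJ.1 _ => a.
  apply: hp_ex_countable cJ.1 _ => b; apply: hp_ex_countable (cJ.2 a b) _ => h.
  apply: (hp_ext (P := fun y => (f y 0 = index a /\ g y 0 = index b) /\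
      exists x, R a (tailb (f y)) x /\ R b (tailb (g y)) (dmap h x))).
    move=> y; split=> [[[fa gb] [x [Rx Ry]]]|[x [[fa Rx] [gb Ry]]]].
      by exists x; split; split.
    by split=> //; exists x.
  apply: hp_and; first by apply: hp_and; exact: hp_coord.
  by apply: (hp_rel (hp_dmap h));
    apply: compose_continuous tailb_continuous.
have c1 : continuous (fun z : baire * baire => z.1).
  by apply: fst_comp_continuous; exact: id_continuous.
have c2 : continuous (fun z : baire * baire => z.2).
  by apply: snd_comp_continuous; exact: id_continuous.
apply: hp_and; first by apply: hp_and; exact: hdom.
apply: hp_forall; apply: hp_imp.
  apply: hp_forall; apply: hp_forall; apply: hp_imp.
    apply: hedge; last by apply: fst_comp_continuous; exact: id_continuous.
    by apply: fst_comp_continuous; apply: snd_comp_continuous; exact: id_continuous.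
  have c3 : continuous
      (fun z : baire * (baire * (baire * (baire * baire))) => z.2.2.1).
    apply: fst_comp_continuous; do 2 apply: snd_comp_continuous.
    exact: id_continuous.
  apply: hp_iff; apply: hp_enum => //.
    by apply: fst_comp_continuous; apply: snd_comp_continuous; exact: id_continuous.
  by apply: fst_comp_continuous; exact: id_continuous.
have c4 : continuous (fun z : baire * (baire * baire) => z.1).
  by apply: fst_comp_continuous; exact: id_continuous.
apply: hp_iff; apply: hp_enum => //.
  by apply: fst_comp_continuous; apply: snd_comp_continuous; exact: id_continuous.
by do 2 apply: snd_comp_continuous; exact: id_continuous.
Qed.

Lemma QCB0_HP_colimit : QCB0_HP C.
Proof.
apply: QCB0_HP_of_quotient_rep colimit_kolmogorov colimit_rep_total _ hp_colimit_rep.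
exact: quotient_rep_space.
Qed.

Lemma colimit_is_colimit : is_colimit qcb0 colimit_inj.
Proof.
split.
- exact: QCB0_HP_qcb0 QCB0_HP_colimit.
- split; first exact: colimit_inj_continuous.
  move=> a b f; apply/funext => x; apply: eq_exist; exact: colimit_filter_dmap.
move=> Z j [kZ _] [cj jf].
have jU (O : set Z) : open O -> colimit_nbhd (fun a => j a @^-1` O).
  move=> oO; split=> [a|a b f x]; first by move/continuousP: (cj a); exact.
  by rewrite /= -(jf a b f).
(* Preimages of an open set of [Z] form a compatible family. Elements with the same filter are
   therefore sent to points in the same open sets of [Z], which coincide as [Z] is T0. *)
have /choice[u uP] : forall F : C, exists z, forall a (x : D a),
    F = colimit_inj x -> j a x = z.
  move=> F; have [a [x ->]] := colimit_inj_surj F; exists (j a x) => b y.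
  move=> /(congr1 (fun F : C => sval (F : colimit_points))) /= xy.
  apply: kolmogorov_eq kZ _ => O /jU nO.
  split=> Oz.
    by have [] : colimit_filter x (fun a => j a @^-1` O) by rewrite xy.
  by have [] : colimit_filter y (fun a => j a @^-1` O) by rewrite -xy.
have uE a (x : D a) : u (colimit_inj x) = j a x by rewrite (uP (colimit_inj x)).
exists u; split; last first.
  move=> u' [_ u'j]; apply/funext => F; have [a [x ->]] := colimit_inj_surj F.
  by rewrite uE -(u'j a).
split=> [|a]; last by apply/funext => x; exact: uE.
apply/continuousP => O oO.
have -> : u @^-1` O = [set F : C | sval (F : colimit_points) (fun a => j a @^-1` O)].
  apply/seteqP; split=> F; have [a [x ->]] := colimit_inj_surj F.
    by rewrite /= uE => Ox; split=> //; exact: jU.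
  by move=> [_ /=]; rewrite uE.
exact: colimit_open (jU _ oO).
Qed.

End diagrams.

Lemma QCB0_HP_inherits_limits : inherits_countable_limits qcb0 QCB0_HP.
Proof.
move=> J D cJ hD; have [R [index [ii RP]]] := diagram_rep cJ hD.
have kD a : kolmogorov_space (D a) by exact: QCB0_HP_kolmogorov.
exists _, (@limit_proj J D R index); split; first exact: QCB0_HP_limit.
exact: limit_is_limit.
Qed.

Lemma QCB0_HP_inherits_colimits : inherits_countable_colimits qcb0 QCB0_HP.
Proof.
move=> J D cJ hD; have [R [index [ii RP]]] := diagram_rep cJ hD.
have kD a : kolmogorov_space (D a) by exact: QCB0_HP_kolmogorov.
exists _, (@colimit_inj J D R index); split; first exact: QCB0_HP_colimit.
exact: colimit_is_colimit.
Qed.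

(** * Exponentials *)

(** Points of an abstract product are reached through constant maps from a fixed inhabited
    qcb0-space, here the Baire space. *)
Lemma product_point_ex (A B P : topologicalType) (p1 : P -> A) (p2 : P -> B) :
  is_product qcb0 p1 p2 -> forall a b, exists w, p1 w = a /\ p2 w = b.
Proof.
move=> [_ _ _ uP] a b.
have [u [[_ u1 u2] _]] := uP _ (fun=> a) (fun=> b)
  qcb0_baire (@cst_continuous _ _ a) (@cst_continuous _ _ b).
exists (u (fun=> 0)).
by rewrite -[p1 _]/((p1 \o u) _) -[p2 _]/((p2 \o u) _) u1 u2.
Qed.

Lemma product_point_eq (A B P : topologicalType) (p1 : P -> A) (p2 : P -> B) :
  is_product qcb0 p1 p2 -> forall w w', p1 w = p1 w' -> p2 w = p2 w' -> w = w'.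
Proof.
move=> [_ c1 c2 uP] w w' e1 e2.
have [u [_ uu]] := uP _ (fun=> p1 w) (fun=> p2 w)
  qcb0_baire (@cst_continuous _ _ (p1 w)) (@cst_continuous _ _ (p2 w)).
have uw : u = fun=> w.
  by apply: uu; split=> //; exact: cst_continuous.
have uw' : u = fun=> w'.
  by apply: uu; split; [exact: cst_continuous|rewrite e1|rewrite e2].
by move: (congr1 (fun h => h (fun=> 0)) (etrans (esym uw) uw')).
Qed.

(** * Binary products of represented spaces *)

Section products.
Variables A B : topologicalType.
Variables (RA : baire -> A -> Prop) (RB : baire -> B -> Prop).
Hypotheses (qA : quotient_rep RA) (qB : quotient_rep RB).
Hypotheses (hA : hp (rep_kernel RA)) (hB : hp (rep_kernel RB)).
Hypotheses (aA : admissible_rep RA) (aB : admissible_rep RB).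
Hypotheses (tA : total_rep RA) (tB : total_rep RB).
Hypotheses (kA : kolmogorov_space A) (kB : kolmogorov_space B).

Definition prod_rep (p : baire) (z : A * B) : Prop :=
  RA (fstb p) z.1 /\ RB (sndb p) z.2.

Let P : topologicalType := rep_space prod_rep.

Definition prod_fst (z : P) : A := (z : A * B).1.
Definition prod_snd (z : P) : B := (z : A * B).2.

Lemma prod_fst_continuous : continuous prod_fst.
Proof.
apply/continuousP => U /qA[O oO OU]; exists (fstb @^-1` O).
  by move/continuousP: fstb_continuous; exact.
by move=> p z [R1 _]; exact: OU R1.
Qed.

Lemma prod_snd_continuous : continuous prod_snd.
Proof.
apply/continuousP => U /qB[O oO OU]; exists (sndb @^-1` O).
  by move/continuousP: sndb_continuous; exact.
by move=> p z [_ R2]; exact: OU R2.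
Qed.

Lemma prod_kolmogorov : kolmogorov_space P.
Proof.
apply: kolmogorovP => -[a b] [a' b'] h.
congr pair; [apply: kolmogorov_eq kA _|apply: kolmogorov_eq kB _] => U oU.
  apply: (h (prod_fst @^-1` U)); move: U oU; apply/continuousP.
  exact: prod_fst_continuous.
apply: (h (prod_snd @^-1` U)); move: U oU; apply/continuousP.
exact: prod_snd_continuous.
Qed.

Lemma prod_rep_total : total_rep prod_rep.
Proof.
move=> [a b]; have [p Rp] := tA a; have [q Rq] := tB b.
by exists (pairb p q); split; rewrite ?pairbK1 ?pairbK2.
Qed.

Lemma QCB0_HP_prod : QCB0_HP P.
Proof.
apply: QCB0_HP_of_quotient_rep prod_kolmogorov prod_rep_total _ _.
  exact: quotient_rep_space.
apply: (hp_ext (P := fun z => rep_kernel RA (fstb z.1, fstb z.2) /\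
    rep_kernel RB (sndb z.1, sndb z.2))).
  move=> z; split=> [[[a [a1 a2]] [b [b1 b2]]]|[[a b] [[a1 b1] [a2 b2]]]].
    by exists (a, b).
  by split; [exists a|exists b].
have c1 : continuous (fun z : baire * baire => z.1).
  by apply: fst_comp_continuous; exact: id_continuous.
have c2 : continuous (fun z : baire * baire => z.2).
  by apply: snd_comp_continuous; exact: id_continuous.
apply: hp_and; [apply: (hp_rel hA)|apply: (hp_rel hB)].
- exact: compose_continuous c1 fstb_continuous.
- exact: compose_continuous c2 fstb_continuous.
- exact: compose_continuous c1 sndb_continuous.
- exact: compose_continuous c2 sndb_continuous.
Qed.

Lemma prod_is_product : is_product qcb0 prod_fst prod_snd.
Proof.
split; [exact: QCB0_HP_qcb0 QCB0_HP_prod|exact: prod_fst_continuous|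
        exact: prod_snd_continuous|].
move=> Z f g qZ cf cg; pose u (z : Z) : P := (f z, g z) : A * B.
exists u; split; last first.
  move=> u' [_ fu gu]; apply/funext => z; rewrite /u -fu -gu.
  by rewrite [RHS]surjective_pairing.
split=> //; apply: continuous_of_probes qZ _ => S nu cnu.
have [a ca Ra] := aA (compose_continuous cnu cf).
have [b cb Rb] := aB (compose_continuous cnu cg).
apply: (continuous_to_rep (@quotient_rep_space _ prod_rep) (pairb_continuous ca cb)).
by move=> s; split; rewrite ?pairbK1 ?pairbK2.
Qed.

End products.

(** * Function spaces *)

Section exponentials.
Variables X Y : topologicalType.
Hypothesis kX : kolmogorov_space X.
Hypothesis kY : kolmogorov_space Y.
Variables (RX : baire -> X -> Prop) (RY : baire -> Y -> Prop).
Hypotheses (tX : total_rep RX) (qX : quotient_rep RX).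
Hypotheses (tY : total_rep RY) (qY : quotient_rep RY).
Hypotheses (hX : hp (rep_kernel RX)) (hY : hp (rep_kernel RY)).

Definition cont_maps := {f : X -> Y | continuous f}.

(** [p] represents [f] by enumerating the open set of pairs of a name of [x]
    and a code of an open neighbourhood of [f x]. *)
Definition exp_rep (p : baire) (f : cont_maps) : Prop :=
  forall d x r, RX d x -> open_code RY r ->
    (enum_open p (pairb d r) <-> coded_open RY r (sval f x)).

Let E : topologicalType := rep_space exp_rep.

Lemma exp_eq (f g : E) :
  (forall x, sval (f : cont_maps) x = sval (g : cont_maps) x) -> f = g.
Proof.
case: f g => f fP [g gP] /= fg; apply: eq_exist.
by apply/funext.
Qed.

Lemma enum_open_pairb_continuous (r : baire) (O : set (baire * baire)) :
  open O -> open [set z : baire * baire | O (z.1, pairb z.2 r)].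
Proof.
move: O; apply/continuousP; apply: pair_continuous.
  by apply: fst_comp_continuous; exact: id_continuous.
apply: pairb_continuous; last exact: cst_continuous.
by apply: snd_comp_continuous; exact: id_continuous.
Qed.

(** Currying on names: if evaluation is continuous in a parameter [s] and a name of [x], then
    [open_param] gives an open set of triples of [s], a name and a code. Grouping the last two turns
    it, by [enum_open_param], into names that depend continuously on [s]. *)
Lemma exp_rep_param (S : set baire) (F : S -> E)
    (T := [set p | S (fstb p) /\ rep_dom RX (sndb p)])
    (t1 := fun t : T => (set_valP t).1) (t2 := fun t : T => (set_valP t).2) :
  continuous (fun t : T => sval (F (restr t1 t) : cont_maps)
                             (rep_map (restr t2 t))) ->
  exists2 g : S -> baire, continuous g & forall s, exp_rep (g s) (F s).
Proof.
move=> /(open_param tY qY)[W oW WE].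
have cW : continuous (fun z : baire * baire => (pairb z.1 (fstb z.2), sndb z.2)).
  have c2 : continuous (fun z : baire * baire => z.2).
    by apply: snd_comp_continuous; exact: id_continuous.
  apply: pair_continuous; last exact: compose_continuous c2 sndb_continuous.
  apply: pairb_continuous; last exact: compose_continuous c2 fstb_continuous.
  by apply: fst_comp_continuous; exact: id_continuous.
move/continuousP: cW => /(_ _ oW)/enum_open_param[g cg gW].
exists (fun s => g (set_val s)).
  exact: compose_continuous (@set_val_continuous _ _) cg.
move=> s d x r Rx cr; rewrite gW /= pairbK1 pairbK2.
have Tt : T (pairb (set_val s) d).
  by rewrite /T /= pairbK1 pairbK2; split; [exact: set_valP|exists x].
have := WE (to_set Tt) r cr; rewrite to_setE.
have -> : restr t1 (to_set Tt) = s.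
  by apply: set_val_inj; rewrite restrE to_setE pairbK1.
have -> // : rep_map (restr t2 (to_set Tt)) = x.
apply: (rep_functional tX qX kX (rep_mapP _)).
by rewrite restrE to_setE pairbK2.
Qed.

Lemma exp_rep_total : total_rep exp_rep.
Proof.
move=> f; have [|g _ gP] := @exp_rep_param setT (fun=> f).
  apply: compose_continuous (svalP f).
  apply: compose_continuous (rep_map_continuous qX kX).
  apply: restr_continuous.
  exact: compose_continuous (@set_val_continuous _ _) sndb_continuous.
by exists (g (to_set (I : [set: baire] (fun=> 0)))).
Qed.

Lemma exp_eval_continuous x : continuous (fun f : E => sval (f : cont_maps) x).
Proof.
apply/continuousP => U /(coded_open_surj tY qY)[r cr rU].
have [d Rx] := tX x.
exists [set p | enum_open p (pairb d r)].
  have /continuousP/(_ _ open_enum_open) := pair_continuous (@id_continuous baire)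
    (@cst_continuous baire baire (pairb d r)).
  by [].
by move=> p f /(_ d x r Rx cr) fP; rewrite /= -rU.
Qed.

Lemma exp_kolmogorov : kolmogorov_space E.
Proof. exact: kolmogorov_joint exp_eval_continuous (fun=> kY) exp_eq. Qed.

(** The names of continuous maps, described without quantifying over maps: [p] assigns a value to
    each name, and the same one to names of equal points. Continuity is automatic, because [p]
    itself enumerates the preimages of coded open sets. *)
Definition exp_name (p : baire) : Prop :=
  (forall d, rep_dom RX d -> exists e, rep_dom RY e /\
     forall r, open_code RY r -> (enum_open p (pairb d r) <-> enum_open r e)) /\
  (forall d d', rep_kernel RX (d, d') -> forall r, open_code RY r ->
     (enum_open p (pairb d r) <-> enum_open p (pairb d' r))).

Lemma exp_name_rep p : exp_name p -> exists f, exp_rep p f.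
Proof.
move=> [h1 h2]; have /choice[f fP] : forall x, exists y, forall d r,
    RX d x -> open_code RY r -> (enum_open p (pairb d r) <-> coded_open RY r y).
  move=> x; have [d Rd] := tX x.
  have [|e [[y Re] eP]] := h1 d; first by exists x.
  exists y => d' r Rd' cr; rewrite (coded_openE cr Re) -(eP r cr).
  by apply: h2 => //; exists x.
have cf : continuous f.
  apply/continuousP => U /(coded_open_surj tY qY)[r cr rU]; apply/qX.
  exists [set d | enum_open p (pairb d r)].
    have /continuousP/(_ _ (open_enum_openP p)) := pairb_continuous
      (@id_continuous baire) (@cst_continuous baire baire r).
    by [].
  by move=> d x Rx; rewrite /= -rU; exact: fP.
by exists (exist _ f cf) => d x r Rx cr; exact: fP.
Qed.

Lemma exp_rep_name p f : exp_rep p f -> exp_name p.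
Proof.
move=> pf; split=> [d [x Rx]|d d' [x [Rx Rx']] r cr].
  have [e Re] := tY (sval f x); exists e; split; first by exists (sval f x).
  by move=> r cr; rewrite (pf d x r Rx cr) (coded_openE cr Re).
by rewrite (pf d x r Rx cr) (pf d' x r Rx' cr).
Qed.

Lemma hp_exp_rep : hp (rep_kernel exp_rep).
Proof.
apply: (hp_ext (P := fun z => exp_name z.1 /\ forall d, rep_dom RX d ->
    forall r, open_code RY r ->
    (enum_open z.1 (pairb d r) <-> enum_open z.2 (pairb d r)))).
  move=> z; split=> [[/exp_name_rep[f pf] h]|[f [pf qf]]].
    exists f; split=> // d x r Rx cr; rewrite -(pf d x r Rx cr).
    by symmetry; apply: h => //; exists x.
  split=> [|d [x Rx] r cr]; first exact: exp_rep_name pf.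
  by rewrite (pf d x r Rx cr) (qf d x r Rx cr).
have hen (T : topologicalType) (p d r : T -> baire) : continuous p ->
    continuous d -> continuous r ->
    hp [set t | enum_open (p t) (pairb (d t) (r t))].
  by move=> cp cd cr; apply: hp_enum cp _; exact: pairb_continuous.
have c0 (T : topologicalType) : continuous (fun t : T => t) by exact: id_continuous.
apply: hp_and; last first.
  apply: hp_forall; apply: hp_imp.
    by apply: hp_rep_dom => //; apply: fst_comp_continuous.
  apply: hp_forall; apply: hp_imp.
    by apply: hp_open_code => //; apply: fst_comp_continuous.
  apply: hp_iff; apply: hen.
  - by apply: fst_comp_continuous; do 2 apply: snd_comp_continuous.
  - by apply: fst_comp_continuous; apply: snd_comp_continuous.
  - exact: fst_comp_continuous.
  - by do 3 apply: snd_comp_continuous.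
  - by apply: fst_comp_continuous; apply: snd_comp_continuous.
  - exact: fst_comp_continuous.
apply: hp_and.
  apply: hp_forall; apply: hp_imp.
    by apply: hp_rep_dom => //; apply: fst_comp_continuous.
  apply: hp_ex; apply: hp_and.
    by apply: hp_rep_dom => //; apply: fst_comp_continuous.
  apply: hp_forall; apply: hp_imp.
    by apply: hp_open_code => //; apply: fst_comp_continuous.
  apply: hp_iff.
    apply: hen; last exact: fst_comp_continuous.
      by apply: fst_comp_continuous; do 3 apply: snd_comp_continuous.
    by apply: fst_comp_continuous; do 2 apply: snd_comp_continuous.
  apply: hp_enum; first exact: fst_comp_continuous.
  by apply: fst_comp_continuous; apply: snd_comp_continuous.
apply: hp_forall; apply: hp_forall; apply: hp_imp.
  apply: (hp_rel hX); last exact: fst_comp_continuous.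
  by apply: fst_comp_continuous; apply: snd_comp_continuous.
apply: hp_forall; apply: hp_imp.
  by apply: hp_open_code => //; apply: fst_comp_continuous.
apply: hp_iff; apply: hen.
- by apply: fst_comp_continuous; do 3 apply: snd_comp_continuous.
- by apply: fst_comp_continuous; do 2 apply: snd_comp_continuous.
- exact: fst_comp_continuous.
- by apply: fst_comp_continuous; do 3 apply: snd_comp_continuous.
- by apply: fst_comp_continuous; apply: snd_comp_continuous.
- exact: fst_comp_continuous.
Qed.

Lemma QCB0_HP_exp : QCB0_HP E.
Proof.
apply: QCB0_HP_of_quotient_rep exp_kolmogorov exp_rep_total _ hp_exp_rep.
exact: quotient_rep_space.
Qed.

Hypothesis aX : admissible_rep RX.
Hypothesis qcX : qcb0 X.
(** A second representation of the same space, admissible by assumption. The product with [X] is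
    formed with it, since the universal property of the product requires lifts. *)
Variable RE : baire -> E -> Prop.
Hypotheses (tE : total_rep RE) (qE : quotient_rep RE).
Hypotheses (hE : hp (rep_kernel RE)) (aE : admissible_rep RE).

Let P : topologicalType := rep_space (prod_rep RE RX).

Definition exp_ev (z : P) : Y :=
  let: (f, x) := z : E * X in sval (f : cont_maps) x.

(** A name in [RE] does not display the values of a map, while a name in [exp_rep] does. The passage
    from one to the other is [probe_open] for [exp_rep], with names of the argument as
    parameters. *)
Lemma exp_ev_continuous : continuous exp_ev.
Proof.
apply/continuousP => U /(coded_open_surj tY qY)[r cr rU].
pose T := rep_dom (prod_rep RE RX).
have TP (t : T) : prod_rep RE RX (set_val t) (rep_map t) := rep_mapP t.
have o : open [set t : T | exists2 x, RX (sndb (set_val t)) x &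
    coded_open RY r (sval ((rep_map t).1 : cont_maps) x)].
  apply: (@probe_open E T exp_rep (rep_dom RX)
    (fun f d => exists2 x, RX d x & coded_open RY r (sval (f : cont_maps) x))
    [set z | enum_open z.1 (pairb z.2 r)] (fun t => (rep_map t).1)
    (fun t => sndb (set_val t))).
  - exact: exp_rep_total.
  - exact: quotient_rep_space.
  - by apply: first_countable_set; exact: first_countable_baire.
  - exact: enum_open_pairb_continuous open_enum_open.
  - move=> p f d pf [x Rx]; rewrite /= (pf d x r Rx cr).
    split=> [|[x' Rx']]; first by exists x.
    by rewrite (rep_functional tX qX kX Rx Rx').
  - apply: (continuous_to_rep qE (g := fun t => fstb (set_val t))).
      exact: compose_continuous (@set_val_continuous _ _) fstb_continuous.
    by move=> t; exact: (TP t).1.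
  - exact: compose_continuous (@set_val_continuous _ _) sndb_continuous.
  - by move=> t; exists (rep_map t).2; exact: (TP t).2.
have [O oO OE] := open_set_type o; exists O => // p [f x] [/= pf px].
have Tp : T p by exists (f, x).
have <- : set_val (to_set Tp) = p by rewrite to_setE.
have -> : O (set_val (to_set Tp)) = (set_val @^-1` O) (to_set Tp) by [].
rewrite OE /= to_setE -rU /=.
have := TP (to_set Tp); rewrite /prod_rep to_setE => -[pf' px'].
rewrite (rep_functional tE qE exp_kolmogorov pf' pf).
split=> [[x' Rx']|]; last by exists x.
by rewrite (rep_functional tX qX kX Rx' px).
Qed.

Lemma exp_is_exponential :
  is_exponential qcb0 (@prod_fst _ _ RE RX) (@prod_snd _ _ RE RX) exp_ev.
Proof.
have prodP : is_product qcb0 (@prod_fst _ _ RE RX) (@prod_snd _ _ RE RX).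
  exact: prod_is_product exp_kolmogorov kX.
split; [exact: QCB0_HP_qcb0 QCB0_HP_exp|exact: prodP|exact: exp_ev_continuous|].
move=> Z Q q1 q2 f qZ prodQ cf.
have [qQ cq1 cq2 uQ] := prodQ.
(* [pt] identifies the points of the abstract product [Q] with pairs; it need not be continuous for
   the product topology. *)
have /choice[pt ptP] : forall zx : Z * X, exists w, q1 w = zx.1 /\ q2 w = zx.2.
  by move=> [z x]; exact: product_point_ex prodQ z x.
have ptE w : pt (q1 w, q2 w) = w.
  by have [e1 e2] := ptP (q1 w, q2 w); exact: product_point_eq prodQ _ _ e1 e2.
(* Continuity holds along two continuous maps from a qcb0-space, where the universal property of [Q]
   supplies the pairing. *)
have pt_continuous (T : topologicalType) (a : T -> Z) (b : T -> X) : qcb0 T ->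
    continuous a -> continuous b -> continuous (fun t => f (pt (a t, b t))).
  move=> qT ca cb; have [u [[cu ua ub] _]] := uQ T a b qT ca cb.
  have -> : (fun t => f (pt (a t, b t))) = (fun t => f (u t)); last first.
    exact: compose_continuous cu cf.
  by apply/funext => t; rewrite -ua -ub ptE.
pose g (z : Z) : E := exist _ (fun x => f (pt (z, x)))
  (@pt_continuous X (fun=> z) id qcX (@cst_continuous _ _ z) (@id_continuous X))
  : cont_maps.
have cg : continuous g.
  apply: continuous_of_probes qZ _ => S nu cnu.
  have [|n cn nP] := @exp_rep_param S (fun s => g (nu s)).
    apply: (@pt_continuous); first exact: qcb0_baire_set.
      apply: compose_continuous cnu; apply: restr_continuous.
      exact: compose_continuous (@set_val_continuous _ _) fstb_continuous.
    apply: compose_continuous (rep_map_continuous qX kX); apply: restr_continuous.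
    exact: compose_continuous (@set_val_continuous _ _) sndb_continuous.
  exact: continuous_to_rep (@quotient_rep_space _ exp_rep) cn nP.
exists g; split.
  split=> //; have [_ _ _ uP] := prodP.
  have [h [[ch h1 h2] _]] := uP Q (g \o q1) q2 qQ (compose_continuous cq1 cg) cq2.
  exists h; split=> //; apply/funext => w.
  have e1 : prod_fst (h w) = g (q1 w).
    by rewrite -[LHS]/((@prod_fst _ _ RE RX \o h) w) h1.
  have e2 : prod_snd (h w) = q2 w by rewrite -h2.
  rewrite /= /exp_ev; case: (h w) e1 e2 => a b /= -> ->.
  by rewrite /= ptE.
move=> g' [cg' [h [ch h1 h2 he]]]; apply/funext => z; apply: exp_eq => x /=.
have [e1 e2] := ptP (z, x); rewrite -he /=.
have f1 : prod_fst (h (pt (z, x))) = g' z.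
  by rewrite -[LHS]/((@prod_fst _ _ RE RX \o h) _) h1 /= e1.
have f2 : prod_snd (h (pt (z, x))) = x by rewrite -[RHS]e2 -h2.
by rewrite /exp_ev; case: (h _) f1 f2 => a b /= -> ->.
Qed.

End exponentials.

Lemma QCB0_HP_inherits_exponentials : inherits_exponentials qcb0 QCB0_HP.
Proof.
move=> X Y hX hY; have kX := QCB0_HP_kolmogorov hX.
have kY := QCB0_HP_kolmogorov hY.
have [RX [tX qX kerX aX]] := QCB0_HP_rep hX.
have [RY [tY qY kerY _]] := QCB0_HP_rep hY.
have hE := QCB0_HP_exp kX kY tX qX tY qY kerX kerY.
have [RE [tE qE kerE aE]] := QCB0_HP_rep hE.
exists _, _, (@prod_fst _ _ RE RX), (@prod_snd _ _ RE RX), (@exp_ev _ _ RX RY RE).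
split=> //; apply: exp_is_exponential => //; exact: QCB0_HP_qcb0.
Qed.

(** * Minimality *)

Section homeomorphic_closure.
Variable C : space_class.

Definition homeo_closure : space_class :=
  fun X => exists Y, C Y /\ homeomorphic X Y.

Lemma homeo_closure_sub X : C X -> homeo_closure X.
Proof.
move=> CX; exists X; split=> //; exists id, id.
by split=> //; exact: id_continuous.
Qed.

Lemma limit_unique (K : space_class) (J : category) (D : diagram J)
    (L L' : topologicalType) (p : forall a, L -> D a) (p' : forall a, L' -> D a) :
  is_limit K p -> is_limit K p' -> homeomorphic L L'.
Proof.
move=> [KL cp uL] [KL' cp' uL'].
have [u [[cu pu] _]] := uL' L p KL cp.
have [v [[cv pv] _]] := uL L' p' KL' cp'.
have [w [_ uw]] := uL L p KL cp; have [w' [_ uw']] := uL' L' p' KL' cp'.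
exists u, v; split=> // x.
  have e1 : w = v \o u.
    apply: uw; split=> [|a]; first exact: compose_continuous cu cv.
    by rewrite compA pv pu.
  have e2 : w = id by apply: uw; split=> //; exact: id_continuous.
  by rewrite -[LHS]/((v \o u) x) -e1 e2.
have e1 : w' = u \o v.
  apply: uw'; split=> [|a]; first exact: compose_continuous cv cu.
  by rewrite compA pu pv.
have e2 : w' = id by apply: uw'; split=> //; exact: id_continuous.
by rewrite -[LHS]/((u \o v) x) -e1 e2.
Qed.

Lemma colimit_unique (K : space_class) (J : category) (D : diagram J)
    (L L' : topologicalType) (i : forall a, D a -> L) (i' : forall a, D a -> L') :
  is_colimit K i -> is_colimit K i' -> homeomorphic L L'.
Proof.
move=> [KL ci uL] [KL' ci' uL'].
have [u [[cu iu] _]] := uL L' i' KL' ci'.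
have [v [[cv iv] _]] := uL' L i KL ci.
have [w [_ uw]] := uL L i KL ci; have [w' [_ uw']] := uL' L' i' KL' ci'.
exists u, v; split=> // x.
  have e1 : w = v \o u.
    apply: uw; split=> [|a]; first exact: compose_continuous cu cv.
    by rewrite -compA iu iv.
  have e2 : w = id by apply: uw; split=> //; exact: id_continuous.
  by rewrite -[LHS]/((v \o u) x) -e1 e2.
have e1 : w' = u \o v.
  apply: uw'; split=> [|a]; first exact: compose_continuous cv cu.
  by rewrite -compA iv iu.
have e2 : w' = id by apply: uw'; split=> //; exact: id_continuous.
by rewrite -[LHS]/((u \o v) x) -e1 e2.
Qed.

(** Arrows are conjugated by chosen homeomorphisms; cancellation preserves identities and
    composition. *)
Lemma diagram_in_closure (J : category) (D : diagram J) :
  (forall a, homeo_closure (D a)) ->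
  exists (D' : diagram J) (h : forall a, D a -> D' a) (k : forall a, D' a -> D a),
    (forall a, C (D' a)) /\
    [/\ forall a, continuous (h a), forall a, continuous (k a),
        forall a, cancel (h a) (k a), forall a, cancel (k a) (h a)
      & forall a b (f : hom a b) x, dmap f (k a x) = k b (dmap f x)].
Proof.
move=> hD; pose Y a := sval (cid (hD a)); have YP a := svalP (cid (hD a)).
pose h a := sval (cid (YP a).2); have hP a := svalP (cid (YP a).2).
pose k a := sval (cid (hP a)); have kP a := svalP (cid (hP a)).
have ch a : continuous (h a) by case: (kP a).
have ck a : continuous (k a) by case: (kP a).
have hk a : cancel (h a) (k a) by case: (kP a).
have kh a : cancel (k a) (h a) by case: (kP a).
pose m a b (f : hom a b) (y : Y a) : Y b := h b (dmap f (k a y)).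
have cm a b (f : hom a b) : continuous (m a b f).
  apply: compose_continuous (ch b); apply: compose_continuous (ck a) _.
  exact: dmap_continuous.
have idm' a : m a a (idm a) = id.
  by apply/funext => y; rewrite /m dmap_id kh.
have compm a b c (g : hom b c) (f : hom a b) :
    m a c (Defs.comp g f) = m b c g \o m a b f.
  by apply/funext => y; rewrite /m dmap_comp /= hk.
exists (Diagram cm idm' compm), h, k; split=> [a|]; first exact: (YP a).1.
by split=> // a b f x; rewrite /= /m hk.
Qed.

Hypothesis limC : inherits_countable_limits qcb0 C.
Hypothesis colimC : inherits_countable_colimits qcb0 C.

(** [C] is only known to contain some limit of the transported diagram. Its projections followed by
    [k] form a limit of [D], so any concrete limit [L] is a copy of it. *)
Lemma homeo_closure_limit (J : category) (D : diagram J) (L : topologicalType)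
    (p : forall a, L -> D a) : countable_category J ->
  (forall a, homeo_closure (D a)) -> is_limit qcb0 p -> homeo_closure L.
Proof.
move=> cJ /diagram_in_closure[D' [h [k [CD' [ch ck hk kh kD]]]]] limp.
have [L' [p' [CL' [qL' [cp' p'f] uL']]]] := limC cJ CD'.
exists L'; split=> //.
apply: (limit_unique limp (p' := fun a => k a \o p' a)); split=> //.
  split=> [a|a b f]; first exact: compose_continuous (cp' a) (ck a).
  by apply/funext => x; rewrite /= kD -(p'f a b f).
move=> Z q qZ [cq qf].
have hqf a b (f : hom a b) : dmap f \o (h a \o q a) = h b \o q b.
  apply/funext => z; rewrite -(qf a b f) /=.
  by rewrite -[in RHS](hk a (q a z)) kD kh.
have [|u [[cu pu] uu]] := uL' Z (fun a => h a \o q a) qZ.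
  by split=> // a; exact: compose_continuous (cq a) (ch a).
exists u; split=> [|u' [cu' pu']].
  by split=> // a; apply/funext => z; rewrite /= -[p' a _]/((p' a \o u) z) pu /= hk.
apply: uu; split=> // a; apply/funext => z.
by rewrite -(pu' a) /= kh.
Qed.

Lemma homeo_closure_colimit (J : category) (D : diagram J) (L : topologicalType)
    (i : forall a, D a -> L) : countable_category J ->
  (forall a, homeo_closure (D a)) -> is_colimit qcb0 i -> homeo_closure L.
Proof.
move=> cJ /diagram_in_closure[D' [h [k [CD' [ch ck hk kh kD]]]]] colimi.
have [L' [i' [CL' [qL' [ci' i'f] uL']]]] := colimC cJ CD'.
exists L'; split=> //.
have hD a b (f : hom a b) x : h b (dmap f x) = dmap f (h a x).
  by rewrite -[in LHS](hk a x) kD kh.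
apply: (colimit_unique colimi (i' := fun a => i' a \o h a)); split=> //.
  split=> [a|a b f]; first exact: compose_continuous (ch a) (ci' a).
  by apply/funext => x; rewrite /= hD -(i'f a b f).
move=> Z q qZ [cq qf].
have [|u [[cu pu] uu]] := uL' Z (fun a => q a \o k a) qZ.
  split=> [a|a b f]; first exact: compose_continuous (ck a) (cq a).
  by apply/funext => x; rewrite /= -kD -(qf a b f).
exists u; split=> [|u' [cu' pu']].
  split=> // a; apply/funext => x.
  by rewrite /= -[u _]/((u \o i' a) (h a x)) pu /= hk.
apply: uu; split=> // a; apply/funext => x.
by rewrite -(pu' a) /= kh.
Qed.

End homeomorphic_closure.

(** * Discrete diagrams and parallel pairs *)

Definition discrete_cat (I : Type) : category :=
  @Category I (fun a b => a = b) (fun a => erefl)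
    (fun a b c g f => etrans f g)
    (fun a b f => match f with erefl => erefl end)
    (fun a b f => match f with erefl => erefl end)
    (fun a b c d h g f => match h with erefl => erefl end).

Lemma discrete_cat_countable (I : Type) : countable [set: I] ->
  countable_category (discrete_cat I).
Proof.
move=> cI; split=> // a b; apply/countable_injP; exists (fun=> 0) => e e' _ _ _.
exact: (@Prop_irrelevance (a = b :> I)).
Qed.

Lemma discrete_dmap_continuous I (T : I -> topologicalType) (a b : I)
  (e : a = b) : continuous (fun x : T a => ecast c (T c) e x).
Proof. by case: b / e => x. Qed.

Definition discrete_diagram (I : Type) (T : I -> topologicalType) :
  diagram (discrete_cat I) :=
  @Diagram (discrete_cat I) T (fun a b (e : a = b) x => ecast c (T c) e x)
    (@discrete_dmap_continuous I T) (fun a => erefl)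
    (fun a b c g f => match g with erefl => erefl end).

(** [false] is the source and [true] the target; the two parallel arrows are the booleans. *)
Definition parallel_hom (a b : bool) : Type :=
  match a, b with
  | false, true => bool
  | true, false => Empty_set
  | _, _ => unit
  end.

Definition parallel_comp (a b c : bool) :
    parallel_hom b c -> parallel_hom a b -> parallel_hom a c :=
  match a, b, c with
  | false, false, true => fun g _ => g
  | false, true, true => fun _ f => f
  | true, false, _ => fun _ f => match f with end
  | _, true, false => fun g _ => match g with end
  | true, true, true | false, false, false => fun _ _ => tt
  end.

Lemma parallel_idl a b (f : parallel_hom a b) :
  parallel_comp (if b return parallel_hom b b then tt else tt) f = f.
Proof. by case: a b f => [] [] // []. Qed.

Lemma parallel_idr a b (f : parallel_hom a b) :
  parallel_comp f (if a return parallel_hom a a then tt else tt) = f.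
Proof. by case: a b f => [] [] // []. Qed.

Lemma parallel_assoc a b c d (h : parallel_hom c d) (g : parallel_hom b c)
    (f : parallel_hom a b) :
  parallel_comp h (parallel_comp g f) = parallel_comp (parallel_comp h g) f.
Proof. by case: a b c d h g f => [] [] [] [] // [] // [] // []. Qed.

Definition parallel_cat : category :=
  @Category bool parallel_hom
    (fun a => if a return parallel_hom a a then tt else tt)
    parallel_comp parallel_idl parallel_idr parallel_assoc.

Lemma parallel_cat_countable : countable_category parallel_cat.
Proof.
split; first exact: countableP.
by case=> [] []; exact: countableP.
Qed.

Section parallel_diagram.
Variables (X Y : topologicalType) (f g : X -> Y).
Hypotheses (cf : continuous f) (cg : continuous g).

Definition parallel_obj (a : bool) : topologicalType := if a then Y else X.

Definition parallel_map (a b : bool) :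
    parallel_hom a b -> parallel_obj a -> parallel_obj b :=
  match a, b with
  | false, true => fun h => if h : bool then f else g
  | true, false => fun h => match h with end
  | true, true => fun _ => id
  | false, false => fun _ => id
  end.

Lemma parallel_map_continuous a b (h : parallel_hom a b) :
  continuous (parallel_map h).
Proof.
by case: a b h => [] [] // h; [exact: id_continuous|case: h|exact: id_continuous].
Qed.

Lemma parallel_map_id a :
  parallel_map (if a return parallel_hom a a then tt else tt) = id.
Proof. by case: a. Qed.

Lemma parallel_map_comp a b c (h : parallel_hom b c) (k : parallel_hom a b) :
  parallel_map (parallel_comp h k) = parallel_map h \o parallel_map k.
Proof. by case: a b c h k => [] [] [] // [] // []. Qed.

Definition parallel_diagram : diagram parallel_cat :=
  @Diagram parallel_cat parallel_obj parallel_map parallel_map_continuous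
    parallel_map_id parallel_map_comp.

End parallel_diagram.

(** * Constructions available in an inheriting subcategory *)

Section minimality.
Variable C : space_class.
Hypothesis hC : inheriting_subcategory C.

Let CS : C sierpinski. Proof. by case: hC. Qed.
Let expC : inherits_exponentials qcb0 C. Proof. by case: hC. Qed.
Let limC : inherits_countable_limits qcb0 C. Proof. by case: hC. Qed.
Let colimC : inherits_countable_colimits qcb0 C. Proof. by case: hC. Qed.

Lemma homeo_closure_product (I : Type) (T : I -> topologicalType)
    (L : topologicalType) (p : forall a, L -> T a) : countable [set: I] ->
  (forall a, homeo_closure C (T a)) -> qcb0 L -> (forall a, continuous (p a)) ->
  (forall x y, (forall a, p a x = p a y) -> x = y) ->
  (forall (Z : topologicalType) (q : forall a, Z -> T a),
    (forall a, continuous (q a)) ->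
    exists2 u : Z -> L, continuous u & forall a z, p a (u z) = q a z) ->
  homeo_closure C L.
Proof.
move=> cI hT qL cp inj univ.
apply: (homeo_closure_limit limC (D := discrete_diagram T) (p := p)) => //.
  exact: discrete_cat_countable.
split=> //; first by split=> // a b e; apply/funext => x; case: b / e.
move=> Z q _ [cq _]; have [u cu pu] := univ Z q cq.
exists u; split=> [|u' [_ pu']].
  by split=> // a; apply/funext => z; exact: pu.
by apply/funext => z; apply: inj => a; rewrite pu -(pu' a).
Qed.

Lemma homeo_closure_coproduct (I : Type) (T : I -> topologicalType)
    (L : topologicalType) (i : forall a, T a -> L) : countable [set: I] ->
  (forall a, homeo_closure C (T a)) -> qcb0 L -> (forall a, continuous (i a)) ->
  (forall y, exists a x, y = i a x) ->
  (forall (Z : topologicalType) (j : forall a, T a -> Z),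
    (forall a, continuous (j a)) ->
    exists2 u : L -> Z, continuous u & forall a x, u (i a x) = j a x) ->
  homeo_closure C L.
Proof.
move=> cI hT qL ci surj univ.
apply: (homeo_closure_colimit colimC (D := discrete_diagram T) (i := i)) => //.
  exact: discrete_cat_countable.
split=> //; first by split=> // a b e; apply/funext => x; case: b / e.
move=> Z j _ [cj _]; have [u cu uj] := univ Z j cj.
exists u; split=> [|u' [_ uj']].
  by split=> // a; apply/funext => x; exact: uj.
by apply/funext => y; have [a [x ->]] := surj y; rewrite uj -(uj' a).
Qed.

(** A subspace of a qcb0-space can fail to be qcb0, so this is assumed of the equalizer; the
    subspace topology then gives the universal property. *)
Lemma homeo_closure_equalizer (X Y : topologicalType) (f g : X -> Y) :
  homeo_closure C X -> homeo_closure C Y -> continuous f -> continuous g ->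
  qcb0 [set x | f x = g x] -> homeo_closure C [set x | f x = g x].
Proof.
move=> hX hY cf cg qE; set E := [set x | f x = g x] in qE *.
have Efg (x : E) : f (set_val x) = g (set_val x) by exact: set_valP x.
pose p (a : bool) : E -> parallel_obj X Y a :=
  if a return E -> parallel_obj X Y a then f \o set_val else set_val.
apply: (homeo_closure_limit limC (D := parallel_diagram cf cg) (p := p)).
- exact: parallel_cat_countable.
- by case.
split=> //.
  split=> [[]|].
  - exact: compose_continuous (@set_val_continuous _ _) cf.
  - exact: set_val_continuous.
  - move=> [] [] //= [] //.
    by apply/funext => x; rewrite /= Efg.
move=> Z q _ [cq qf].
have qfg z : E (q false z).
  have := qf false true true; have := qf false true false => /= <-.
  by move/(congr1 (fun h => h z)).
exists (restr qfg); split=> [|u [cu pu]].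
  split; first by apply: restr_continuous; exact: cq false.
  have := qf false true true => /= qt.
  by case; apply/funext => z; rewrite /= restrE // -qt.
apply/funext => z; apply: set_val_inj; rewrite restrE.
by rewrite -(pu false).
Qed.

Lemma homeo_closure_quotient (X : topologicalType) (R : baire -> X -> Prop) :
  qcb0 X -> total_rep R -> quotient_rep R -> homeo_closure C (rep_dom R) ->
  homeo_closure C (rep_kernel R) -> homeo_closure C X.
Proof.
move=> qX tR qR hD hK; have kX := qX.1.
have d1 (z : rep_kernel R) : rep_dom R (set_val z).1.
  by have [x []] := set_valP z; exists x.
have d2 (z : rep_kernel R) : rep_dom R (set_val z).2.
  by have [x []] := set_valP z; exists x.
have c1 : continuous (restr d1).
  by apply: restr_continuous; apply: fst_comp_continuous; exact: set_val_continuous.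
have c2 : continuous (restr d2).
  by apply: restr_continuous; apply: snd_comp_continuous; exact: set_val_continuous.
have mapE (p : rep_dom R) x : R (set_val p) x -> rep_map p = x.
  by move=> Rx; exact: (rep_functional tR qR kX (rep_mapP p) Rx).
have e12 z : rep_map (restr d1 z) = rep_map (restr d2 z).
  have [x [R1 R2]] := set_valP z.
  by rewrite (@mapE _ x) ?(@mapE _ x) // restrE.
pose i (a : bool) : parallel_obj (rep_kernel R) (rep_dom R) a -> X :=
  if a return parallel_obj (rep_kernel R) (rep_dom R) a -> X
  then @rep_map X R else fun z => rep_map (restr d1 z).
apply: (homeo_closure_colimit colimC (D := parallel_diagram c1 c2) (i := i)).
- exact: parallel_cat_countable.
- by case.
split=> //.
  split=> [[]|].
  - exact: rep_map_continuous.
  - exact: compose_continuous c1 (rep_map_continuous qR kX).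
  - move=> [] [] //= [] //.
    by apply/funext => z; rewrite /= e12.
move=> Z j _ [cj jf].
have j1 z : j true (restr d1 z) = j false z by rewrite -(jf false true true).
have j2 z : j true (restr d2 z) = j false z by rewrite -(jf false true false).
have jE (p q : rep_dom R) x : R (set_val p) x -> R (set_val q) x ->
    j true p = j true q.
  move=> Rp Rq; have K : rep_kernel R (set_val p, set_val q) by exists x.
  have e1 : p = restr d1 (to_set K) by apply: set_val_inj; rewrite restrE to_setE.
  have e2 : q = restr d2 (to_set K) by apply: set_val_inj; rewrite restrE to_setE.
  transitivity (j false (to_set K)); first by rewrite -j1 -e1.
  by rewrite -j2 -e2.
have /choice[u uP] : forall x, exists z, forall p : rep_dom R,
    R (set_val p) x -> j true p = z.
  move=> x; have [p Rp] := tR x; have Dp : rep_dom R p by exists x.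
  exists (j true (to_set Dp)) => q Rq.
  by apply: (jE _ _ x) => //; rewrite to_setE.
have uE p : u (rep_map p) = j true p by rewrite (uP (rep_map p)) //; exact: rep_mapP.
exists u; split=> [|u' [cu' uj']].
  split.
    apply/continuousP => O oO; apply/qR.
    have /continuousP/(_ _ oO)/open_set_type[V oV VE] := cj true.
    exists V => // p x Rp; have Dp : rep_dom R p by exists x.
    have Rx : R (set_val (to_set Dp)) x by rewrite to_setE.
    have <- : set_val (to_set Dp) = p by rewrite to_setE.
    rewrite -[V _]/((set_val @^-1` V) (to_set Dp)) VE /=.
    by rewrite -uE (mapE _ _ Rx).
  case; apply/funext => z; first exact: uE.
  by rewrite /= uE j1.
apply/funext => x; have [p Rp] := tR x; have Dp : rep_dom R p by exists x.
have <- : rep_map (to_set Dp) = x by apply: mapE; rewrite to_setE.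
by rewrite uE -(uj' true).
Qed.

(** * The point, the natural numbers and the Baire space *)

Lemma discrete_continuous (Y : topologicalType) (f : nat -> Y) : continuous f.
Proof. by apply/continuousP => A _; exact: discrete_open. Qed.

Lemma qcb0_nat : qcb0 nat.
Proof.
apply: qcb0_second_countable.
  apply: accessible_kolmogorov; apply: hausdorff_accessible.
  exact: discrete_hausdorff.
exact: second_countable_nat.
Qed.

Let point : set baire := [set (fun=> 0)].

Let point_eq (x y : point) : x = y.
Proof. by apply: set_val_inj; rewrite (set_valP x) (set_valP y). Qed.

Let pt : point := to_set (erefl : point (fun=> 0)).

(** The one-point space is the product of the empty family. *)
Lemma homeo_closure_point : homeo_closure C point.
Proof.
apply: (homeo_closure_product (T := fun a : Empty_set => point)
  (p := fun a => match a with end)).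
- exact: countableP.
- by case.
- exact: qcb0_baire_set.
- by case.
- by move=> x y _; exact: point_eq.
- by move=> Z q _; exists (fun=> pt); [exact: cst_continuous|case].
Qed.

Lemma homeo_closure_nat : homeo_closure C nat.
Proof.
apply: (homeo_closure_coproduct (T := fun _ : nat => point) (i := fun n _ => n)).
- exact: countableP.
- by move=> _; exact: homeo_closure_point.
- exact: qcb0_nat.
- by move=> n; exact: cst_continuous.
- by move=> n; exists n, pt.
move=> Z j _; exists (fun n => j n pt); first exact: discrete_continuous.
by move=> n x; rewrite (point_eq x pt).
Qed.

Lemma homeo_closure_baire : homeo_closure C baire.
Proof.
apply: (homeo_closure_product (T := fun _ : nat => nat)
  (p := fun n (x : baire) => x n)).
- exact: countableP.
- by move=> _; exact: homeo_closure_nat.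
- exact: qcb0_baire.
- by move=> n; exact: (@proj_continuous nat (fun _ => nat) n).
- by move=> x y xy; apply/funext.
move=> Z q cq; exists (fun z n => q n z) => //.
apply: continuous_baire => z n.
by apply: filterS (cq n z _ (discrete_set1 _)) => w /= ->.
Qed.

(** The invariant of the induction along the hierarchy, which passes from [X] to
    [baire * X]. *)
Definition ambient (X : topologicalType) : Prop :=
  [/\ @second_countable X, open [set z : X * X | z.1 <> z.2]
    & homeo_closure C X].

Lemma ambient_kolmogorov X : ambient X -> kolmogorov_space X.
Proof.
move=> [_ oX _]; apply: kolmogorovP => x y h; apply: contrapT => xy.
have := oX; rewrite openE => /(_ (x, y) xy)[[A B] /= [nA nB] AB].
have [O [oO Ox] OA] : exists2 O, open_nbhs x O & O `<=` A by rewrite nbhsE in nA.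
have Ay : A y by exact: OA _ ((h O oO).1 Ox).
have /AB : (A `*` B) (y, y) by split=> //; exact: nbhs_singleton nB.
by apply.
Qed.

Lemma ambient_qcb0 (X : topologicalType) (A : set X) : ambient X -> qcb0 A.
Proof.
move=> hX; have [sX _ _] := hX; apply: qcb0_second_countable.
  apply: kolmogorov_inj (ambient_kolmogorov hX); first exact: set_val_inj.
  exact: set_val_continuous.
exact: second_countable_set.
Qed.

Lemma ambient_baire : ambient baire.
Proof.
split; [exact: second_countable_baire| |exact: homeo_closure_baire].
rewrite openE => -[p q] /= pq.
have [n pqn] : exists n, p n <> q n.
  by apply: contrapT => h; apply: pq; apply/funext => n; apply: contrapT => e;
    apply: h; exists n.
exists ([set p' | agree n.+1 p p'], [set q' | agree n.+1 q q']).
  by split; apply/nbhs_baireP; exists n.+1.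
move=> [p' q'] [/= /(_ n (leqnn _)) e1 /(_ n (leqnn _)) e2] e.
by apply: pqn; rewrite e1 e2 e.
Qed.

Lemma ambient_prod X : ambient X -> ambient (baire * X)%type.
Proof.
move=> hX; have [sX oX cX] := hX; have [sN oN _] := ambient_baire.
have kNX : kolmogorov_space (baire * X)%type.
  exact: kolmogorov_prod kolmogorov_baire (ambient_kolmogorov hX).
have sNX : @second_countable (baire * X)%type by exact: second_countable_prod.
split=> //; last first.
  apply: (homeo_closure_product (T := fun b : bool => if b then X else baire)
    (p := fun b =>
      if b return baire * X -> (if b then X else baire : topologicalType)
      then snd else fst)).
  - exact: countableP.
  - by case=> //; exact: homeo_closure_baire.
  - exact: qcb0_second_countable.
  - by case=> z; [exact: cvg_snd|exact: cvg_fst].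
  - by move=> [p x] [q y] h; congr pair; [exact: (h false)|exact: (h true)].
  move=> Z q cq; exists (fun z => (q false z, q true z)); last by case.
  by apply: pair_continuous; [exact: (cq false)|exact: (cq true)].
have c11 : continuous (fun z : (baire * X) * (baire * X) => (z.1.1, z.2.1)).
  apply: pair_continuous; apply: fst_comp_continuous.
    by apply: fst_comp_continuous; exact: id_continuous.
  by apply: snd_comp_continuous; exact: id_continuous.
have c22 : continuous (fun z : (baire * X) * (baire * X) => (z.1.2, z.2.2)).
  apply: pair_continuous; apply: snd_comp_continuous.
    by apply: fst_comp_continuous; exact: id_continuous.
  by apply: snd_comp_continuous; exact: id_continuous.
move/continuousP: c11 => /(_ _ oN) o1; move/continuousP: c22 => /(_ _ oX) o2.
have := openU o1 o2; congr open; apply/seteqP; split=> -[[p x] [q y]] /=.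
  by move=> [h [/h]|h [_ /h]].
move=> h; have [pq|pq] := pselect (p = q); last by left.
by right=> xy; apply: h; rewrite pq xy.
Qed.

(** * Open sets and complements of ranges *)

Lemma char_continuous (X : topologicalType) (A : set X) : open A ->
  continuous (fun x => `[< A x >] : sierpinski).
Proof.
move=> oA; apply/continuousP => U [->|->|->].
- by rewrite preimage_set0; exact: open0.
- by move: oA; congr open; apply/seteqP; split=> x /asboolP.
- by rewrite preimage_setT; exact: openT.
Qed.

Lemma homeo_closure_sierpinski : homeo_closure C sierpinski.
Proof. exact: homeo_closure_sub. Qed.

(** An open set is the equalizer of its characteristic map to the Sierpinski space and the constant
    [true]. *)
Lemma homeo_closure_open (X : topologicalType) (A : set X) : ambient X -> open A ->
  homeo_closure C A.
Proof.
move=> hX oA; have [_ _ cX] := hX.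
have AE : A = [set x | (`[< A x >] : sierpinski) = (true : sierpinski)].
  by apply/seteqP; split=> x; [move=> /asboolP|move=> /asboolP].
have := ambient_qcb0 A hX; rewrite AE => qA.
apply: homeo_closure_equalizer qA => //; first exact: homeo_closure_sierpinski.
  exact: char_continuous.
exact: cst_continuous.
Qed.

(** Exponentials are provided for the copy [T'] that belongs to [C], so the second projection is
    made to land there while the product is formed with [T]. *)
Lemma top_product_is_product (X T T' : topologicalType) (a : T -> T')
    (b : T' -> T) : qcb0 (X * T)%type -> continuous a -> continuous b ->
  cancel a b -> cancel b a ->
  is_product qcb0 (fun z : X * T => z.1) (fun z : X * T => a z.2).
Proof.
move=> qXT ca cb ab ba.
split=> //; first by apply: fst_comp_continuous; exact: id_continuous.
  apply: compose_continuous ca; apply: snd_comp_continuous; exact: id_continuous.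
move=> Z f g _ cf cg; exists (fun z => (f z, b (g z))); split.
  split=> //; last by apply/funext => z; rewrite /= ba.
  by apply: pair_continuous => //; exact: compose_continuous cg cb.
move=> u [_ fu gu]; apply/funext => z.
by rewrite -fu -gu /= ab -surjective_pairing.
Qed.

(** The complement of the range of [phi] is the equalizer of two maps from [X]
    into the exponential of the Sierpinski space by [T]: one sends [x] to
    [fun t => x <> phi t], the other is constantly true. *)
Lemma homeo_closure_range_compl (X T : topologicalType) (phi : T -> X) :
  ambient X -> @second_countable T -> kolmogorov_space T -> homeo_closure C T ->
  continuous phi -> homeo_closure C (~` range phi).
Proof.
move=> hX sT kT [T' [CT' [a [b [ca cb ab ba]]]]] cphi.
have [sX oX cX] := hX; have kX := ambient_kolmogorov hX.
have [E [P [p1 [p2 [ev [CE [qE prodP cev uE]]]]]]] := expC CT' CS.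
have qXT (Y : topologicalType) : @second_countable Y -> kolmogorov_space Y ->
    qcb0 (Y * T)%type.
  move=> sY kY; apply: qcb0_second_countable.
    exact: kolmogorov_prod.
  exact: second_countable_prod.
have prodQ (Y : topologicalType) (sY : @second_countable Y)
    (kY : kolmogorov_space Y) :
    is_product qcb0 (fun z : Y * T => z.1) (fun z : Y * T => a z.2).
  exact: top_product_is_product (qXT _ sY kY) ca cb ab ba.
pose F (z : X * T) : sierpinski := `[< z.1 <> phi z.2 >].
have cF : continuous F.
  apply: char_continuous.
  have : continuous (fun z : X * T => (z.1, phi z.2)).
    apply: pair_continuous.
      by apply: fst_comp_continuous; exact: id_continuous.
    apply: compose_continuous cphi; apply: snd_comp_continuous; exact: id_continuous.
  by move/continuousP => /(_ _ oX).
pose G (z : X * T) : sierpinski := true.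
have cG : continuous G by exact: cst_continuous.
have qX : qcb0 X by exact: qcb0_second_countable.
have [f [[cf [hf [chf hf1 hf2 hfe]]] _]] := uE X _ _ _ F qX (prodQ X sX kX) cF.
have [g [[cg [hg [chg hg1 hg2 hge]]] _]] := uE X _ _ _ G qX (prodQ X sX kX) cG.
pose S := ~` range phi.
have sS : @second_countable S by exact: second_countable_set.
have qS : qcb0 S by exact: ambient_qcb0.
pose v (z : S * T) : X * T := (set_val z.1, z.2).
have cv : continuous v.
  apply: pair_continuous; last by apply: snd_comp_continuous; exact: id_continuous.
  apply: compose_continuous (@set_val_continuous _ _).
  by apply: fst_comp_continuous; exact: id_continuous.
(* Over [S] the restrictions of [f] and [g] both transpose the constant map [GS], so uniqueness of
   transposes makes them agree. *)
pose GS (z : S * T) : sierpinski := true.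
have [w [_ uw]] := uE S _ _ _ GS qS (prodQ S sS qS.1) (@cst_continuous _ _ _).
have Fv z : F (v z) = true.
  apply/asboolP => e; apply: (set_valP z.1); exists z.2 => //.
have wf : w = (fun s => f (set_val s)).
  apply: uw; split; first exact: compose_continuous (@set_val_continuous _ _) cf.
  exists (hf \o v); split; first exact: compose_continuous cv chf.
  - by rewrite compA hf1.
  - by rewrite compA hf2.
  - by rewrite compA hfe; apply/funext => z; exact: Fv.
have wg : w = (fun s => g (set_val s)).
  apply: uw; split; first exact: compose_continuous (@set_val_continuous _ _) cg.
  exists (hg \o v); split; first exact: compose_continuous cv chg.
  - by rewrite compA hg1.
  - by rewrite compA hg2.
  - by rewrite compA hge.
have SE : S = [set x | f x = g x].
  apply/seteqP; split=> [x Sx|x /= fg [t _ tx]].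
    have : (fun s : S => f (set_val s)) = (fun s => g (set_val s)) by rewrite -wf.
    by move/(congr1 (fun h => h (to_set Sx))); rewrite to_setE.
  (* Conversely, [f x = g x] gives equal points of [P], hence equal values under [ev], so [x]
     differs from [phi t]. *)
  have e : hf (x, t) = hg (x, t).
    apply: (product_point_eq prodP).
      rewrite -[p1 (hf _)]/((p1 \o hf) (x, t)) -[p1 (hg _)]/((p1 \o hg) (x, t)).
      by rewrite hf1 hg1 /= fg.
    rewrite -[p2 (hf _)]/((p2 \o hf) (x, t)) -[p2 (hg _)]/((p2 \o hg) (x, t)).
    by rewrite hf2 hg2.
  have : F (x, t) = G (x, t) by rewrite -hfe -hge /= e.
  by move/asboolP; apply.
rewrite -/S; move: qS; rewrite SE => qS.
by apply: homeo_closure_equalizer qS => //; exact: homeo_closure_sub.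
Qed.

(** * Set operations on subspaces *)

Section ambient_subspaces.
Variable X : topologicalType.
Hypothesis hX : ambient X.
Implicit Types A B : set X.

Let sX : @second_countable X. Proof. by case: hX. Qed.

Lemma homeo_closure_setC A : homeo_closure C A -> homeo_closure C (~` A).
Proof.
move=> hA; have -> : ~` A = ~` range (set_val : A -> X).
  congr setC; apply/seteqP; split=> [x Ax|x [y _ <-]]; last exact: set_valP.
  by exists (to_set Ax) => //; rewrite to_setE.
apply: homeo_closure_range_compl => //; last exact: set_val_continuous.
  exact: second_countable_set.
exact: (ambient_qcb0 A hX).1.
Qed.

(** The range construction yields complements of projections, so the projection itself is reached as
    a double complement. *)
Lemma homeo_closure_projection (A : set (baire * X)) : homeo_closure C A ->
  homeo_closure C [set x | exists p, A (p, x)].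
Proof.
move=> hA; set S := [set x | _]; have <- : ~` ~` S = S by exact: setCK.
apply: homeo_closure_setC; rewrite /S.
have -> : [set x | exists p, A (p, x)] = range (fun z : A => (set_val z).2).
  apply/seteqP; split=> [x [p Apx]|_ [z _ <-]].
    by exists (to_set Apx) => //; rewrite to_setE.
  by exists (set_val z).1; rewrite -surjective_pairing; exact: set_valP.
have hNX := ambient_prod hX; have [sNX _ _] := hNX.
apply: homeo_closure_range_compl => //.
- exact: second_countable_set.
- exact: (ambient_qcb0 A hNX).1.
- by apply: snd_comp_continuous; exact: set_val_continuous.
Qed.

(** The coproduct of the complements of the [A n] is realised as the subspace [B] of [nat * X]; the
    intersection is the complement of the range of its projection to [X]. *)
Lemma homeo_closure_bigcap (A : nat -> set X) :
  (forall n, homeo_closure C (A n)) -> homeo_closure C (\bigcap_n A n).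
Proof.
move=> hA; pose B := [set z : nat * X | ~ A z.1 z.2].
have sB : @second_countable B.
  apply: second_countable_set; apply: second_countable_prod => //.
  exact: second_countable_nat.
have kB : kolmogorov_space B.
  apply: kolmogorov_inj (kolmogorov_prod qcb0_nat.1 (ambient_kolmogorov hX)).
    exact: set_val_inj.
  exact: set_val_continuous.
have Bi n (x : ~` A n) : B (n, set_val x) by exact: (set_valP x).
have hB : homeo_closure C B.
  apply: (homeo_closure_coproduct (T := fun n => ~` A n)
    (i := fun n => restr (@Bi n))).
  - exact: countableP.
  - by move=> n; exact: homeo_closure_setC.
  - exact: qcb0_second_countable.
  - move=> n; apply: restr_continuous; apply: pair_continuous.
      exact: cst_continuous.
    exact: set_val_continuous.
  - move=> z; have Bz : (~` A (set_val z).1) (set_val z).2 by exact: (set_valP z).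
    exists (set_val z).1, (to_set Bz); apply: set_val_inj.
    by rewrite restrE to_setE -surjective_pairing.
  move=> Z j cj.
  have Bz (z : B) : (~` A (set_val z).1) (set_val z).2 by exact: (set_valP z).
  have uE n (x : ~` A n) (z : B) : set_val z = (n, set_val x) ->
      j (set_val z).1 (to_set (Bz z)) = j n x.
    move=> e; have e1 : (set_val z).1 = n by rewrite e.
    move: (Bz z); rewrite e /= => h; congr (j n _).
    by apply: set_val_inj; rewrite to_setE.
  exists (fun z => j (set_val z).1 (to_set (Bz z))); last first.
    by move=> n x; apply: uE; rewrite restrE.
  (* The first coordinate is locally constant, so near [z] the map is given by the single component
     [j] of that index. *)
  move=> z O /(cj _ _)/nbhs_set_type[V nV VO]; apply/nbhs_set_type.
  rewrite to_setE in nV.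
  exists ([set (set_val z).1] `*` V).
    by exists ([set (set_val z).1], V) => //; split=> //; exact: discrete_set1.
  move=> z' /= [e Vz'].
  have Bz2 : (~` A (set_val z).1) (set_val z').2 by rewrite -e; exact: (set_valP z').
  rewrite (uE (set_val z).1 (to_set Bz2)); last first.
    by rewrite to_setE -e -surjective_pairing.
  by apply: VO; rewrite /= to_setE.
have -> : \bigcap_n A n = ~` range (fun z : B => (set_val z).2).
  apply/seteqP; split=> [x Ax [z _ zx]|x nx n _].
    by apply: (set_valP z); rewrite zx; exact: Ax.
  apply: contrapT => nA; apply: nx.
  have Bx : B (n, x) by [].
  by exists (to_set Bx) => //; rewrite to_setE.
apply: homeo_closure_range_compl => //.
by apply: snd_comp_continuous; exact: set_val_continuous.
Qed.

Lemma homeo_closure_Sigma10 A : Sigma10 A -> homeo_closure C A.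
Proof.
move=> [U [V [oU oV ->]]].
have -> : \bigcup_n (U n `\` V n) = ~` \bigcap_n ~` (U n `\` V n).
  by rewrite setC_bigcap; apply: eq_bigcupr => n _; rewrite setCK.
apply: homeo_closure_setC; apply: homeo_closure_bigcap => n.
apply: homeo_closure_setC.
have -> : U n `\` V n = \bigcap_i (if i is 0 then U n else ~` V n).
  apply/seteqP; split=> [x [Ux nVx] []//|x h].
  by split; [exact: (h 0%N I)|exact: (h 1%N I)].
apply: homeo_closure_bigcap => -[|_]; first exact: homeo_closure_open.
by apply: homeo_closure_setC; exact: homeo_closure_open.
Qed.

End ambient_subspaces.

Lemma homeo_closure_Sigma1 (alpha : countable_ordinal) (X : topologicalType)
    (A : set X) : ambient X -> Sigma1 alpha A -> homeo_closure C A.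
Proof.
rewrite /Sigma1; have wf := @co_wf alpha.
elim/(well_founded_ind (@co_wf alpha)): (co_point alpha) => w IH in X A *.
move=> hX; have hNX := ambient_prod hX.
have [w0|[v vw]|lw] := wo_cases w.
- by rewrite Sigma1_at_zero //; exact: homeo_closure_Sigma10.
- rewrite (Sigma1_at_succ _ vw) => -[_ [B SB <-] <-].
  apply: homeo_closure_projection => //; apply: homeo_closure_setC => //.
  exact: IH vw.1 _ _ hNX SB.
- rewrite (Sigma1_at_limit _ lw) => -[_ [B SB ->] <-].
  apply: homeo_closure_projection => //; apply: homeo_closure_bigcap => // n.
  by have [v vw SBn] := SB n; exact: IH vw _ _ hNX SBn.
Qed.

Lemma QCB0_HP_homeo_closure (X : topologicalType) : QCB0_HP X ->
  homeo_closure C X.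
Proof.
move=> hX; have [R [tR qR hR _]] := QCB0_HP_rep hX.
have hD : hp (rep_dom R) by exact: (hp_rep_dom hR (@id_continuous baire)).
apply: (homeo_closure_quotient (QCB0_HP_qcb0 hX) tR qR).
  have [alpha Sa] := hD; exact: homeo_closure_Sigma1 ambient_baire Sa.
have [alpha Sa] := hR.
exact: homeo_closure_Sigma1 (ambient_prod ambient_baire) Sa.
Qed.

End minimality.

Theorem theorem7p2 :
  inheriting_subcategory QCB0_HP /\
  forall C : space_class, inheriting_subcategory C ->
    forall X : topologicalType, QCB0_HP X ->
      exists Y : topologicalType, C Y /\ homeomorphic X Y.
Proof.
split; last by move=> C hC X; exact: QCB0_HP_homeo_closure.
split; [exact: QCB0_HP_qcb0|exact: QCB0_HP_sierpinski| | |].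
- exact: QCB0_HP_inherits_exponentials.
- exact: QCB0_HP_inherits_limits.
- exact: QCB0_HP_inherits_colimits.
Qed.
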